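(* Let $g\ge2$. Let $\Gamma$ be a tropical curve of genus $g$, let $D$ be a divisor on $\Gamma$ of nonnegative rank, and let $p\in\Gamma$. (1) If $D=K$ is the canonical divisor of $\Gamma$, then $\operatorname{wt}_K(p)\le \frac{g(g-1)}{2}$. (2) If $\deg D>2g-2$, then $\operatorname{wt}_D(p)\le\frac{g(g+1)}{2}$. (3) The bounds in (1) and (2) are optimal in the following sense: for (1), there exist a tropical curve $\Gamma$ of genus $g$ and a point $p\in\Gamma$ such that equality holds; for (2), for each integer $d>2g-2$ there exist a tropical curve $\Gamma$ of genus $g$, a divisor $D\in\operatorname{Div}(\Gamma)$ of degree $d$, and a point $p\in\Gamma$ such that equality holds.
   Context: A tropical curve (metric graph) $\Gamma$ is a compact connected metric space with the path metric in which every point $p$ has an open neighborhood isometric to a star with $m=\operatorname{val}(p)\ge 1$ branches of some radius $\varepsilon>0$ centered at $p$ (equivalently, it is obtained from a finite connected graph with positive edge lengths). Its genus is $\dim_{\mathbb R}H_1(\Gamma,\mathbb R)$. $T_p\Gamma$ is the set of outgoing tangent directions at $p$. $\operatorname{Div}(\Gamma)$ is the free abelian group on the points of $\Gamma$; $D=\sum_p D(p)(p)$, $\deg D=\sum_p D(p)$, and $D$ is effective if all $D(p)\ge 0$. A rational function is a continuous piecewise affine function $f:\Gamma\to\mathbb R$ with integer slopes; $\operatorname{sl}_{p,\nu}(f)$ is its outgoing slope at $p$ along $\nu\in T_p\Gamma$, and $\operatorname{div}(f)=\sum_p\bigl(-\sum_{\nu\in T_p\Gamma}\operatorname{sl}_{p,\nu}(f)\bigr)(p)$.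 $D\sim E$ means $D-E=\operatorname{div}(f)$ for some rational function $f$. The (Baker–Norine) rank $\mathbf r(D)$ is the maximum among $-1$ and the integers $k\ge0$ such that for all $p_1,\dots,p_k\in\Gamma$ the divisor $D-(p_1)-\cdots-(p_k)$ is linearly equivalent to an effective divisor. The canonical divisor is $K=\sum_p(\operatorname{val}(p)-2)(p)$. Gap sequences: for $D$ of degree $d$ and rank $r\ge 0$ and $p\in\Gamma$, $\underline n_D(p)=(n_1<\cdots<n_{r+1})$ lists the positive integers $m$ with $\mathbf r(D-m(p))<\mathbf r(D-(m-1)(p))$; there are exactly $r+1$ of them, all $\le d+1$. The weight is $\operatorname{wt}_D(p)=\sum_{i=1}^{r+1}(n_i-i)$. *)

(* Defs.v *)
From HB Require Import structures.
From mathcomp Require Import all_boot all_order all_algebra.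
From mathcomp Require Import freeg.
From mathcomp Require Import boolp classical_sets reals.

Set Implicit Arguments.
Unset Strict Implicit.
Unset Printing Implicit Defensive.

Import Order.TTheory GRing.Theory Num.Theory.
Local Open Scope ring_scope.

(* A metric graph, given by a finite connected graph (loops and multiple edges
   allowed) with positive edge lengths.  Each edge carries an arbitrary
   reference orientation from [src] to [tgt].  For a connected graph, having an
   edge amounts to every vertex having valence at least 1, i.e. it excludes the
   empty graph and the one-point space. *)
Record tropical_curve (R : realType) := TropicalCurve {
  vertex : finType;
  edge : finType;
  src : edge -> vertex;
  tgt : edge -> vertex;
  len : edge -> R;
  len_gt0 : forall e, 0 < len e;
  edge_nonempty : (0 < #|edge|)%N;
  connected_graph : forall u v : vertex,
    connect (fun x y => [exists e, ((src e == x) && (tgt e == y))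
                                || ((src e == y) && (tgt e == x))]) u v }.

Section TropicalCurve.
Context (R : realType) (G : tropical_curve R).

(* dim H_1(G, R), computed on the cellular chain complex R^E -> R^V, with
   [boundary_mx] acting on row vectors; H_1 is its kernel. *)
Definition boundary_mx : 'M[R]_(#|edge G|, #|vertex G|) :=
  \matrix_(i, j) ((tgt (enum_val i) == enum_val j)%:R
                  - (src (enum_val i) == enum_val j)%:R).

Definition genus : nat := \rank (kermx boundary_mx).

(* The set underlying the metric graph: a point is a vertex, or (e, x) with
   0 < x < len e, the interior point of e at distance x from [src e] along e. *)
Definition is_point (q : vertex G + edge G * R) : bool :=
  if q is inr (e, x) then 0 < x < len e else true.

Record curve_point := Point { point_val : vertex G + edge G * R;
                        _ : is_point point_val }.

HB.instance Definition _ := [isSub for point_val].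
HB.instance Definition _ := [Choice of curve_point by <:].

Definition vtx (v : vertex G) : curve_point := @Point (inl v) isT.

(* The parametrisation [0, len e] -> G of the closed edge e; values of x
   outside that interval are sent to the nearest end. *)
Definition edge_point (e : edge G) (x : R) : curve_point :=
  insubd (vtx (if x <= 0 then src e else tgt e)) (inr (e, x)).

(* A half-edge (e, b) is the edge e travelled away from [src e] if b = true
   and away from [tgt e] if b = false. *)
Definition half_edge : finType := (edge G * bool)%type.

Definition origin (h : half_edge) : vertex G :=
  if h.2 then src h.1 else tgt h.1.

(* T_p G; a loop contributes two directions at its vertex. *)
Definition tangent (p : curve_point) : {set half_edge} :=
  match point_val p with
  | inl v => [set h | origin h == v]%SET
  | inr (e, _) => [set h | h.1 == e]%SET
  end.

Definition valence (p : curve_point) : nat := #|tangent p|.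

Definition coordinate (p : curve_point) (h : half_edge) : R :=
  match point_val p with
  | inl _ => if h.2 then 0 else len h.1
  | inr (_, x) => x
  end.

(* The point reached from p after travelling a small distance t along h. *)
Definition travel (p : curve_point) (h : half_edge) (t : R) : curve_point :=
  edge_point h.1 (if h.2 then coordinate p h + t else coordinate p h - t).

Definition affine_on (phi : R -> R) (a b : R) : Prop :=
  exists m : int, forall x, a <= x <= b -> phi x = phi a + m%:~R * (x - a).

(* phi is affine with integer slope on each closed interval of a subdivision
   0 = s_0 < s_1 < ... < s_n = l; in particular it is continuous on [0, l]. *)
Definition piecewise_affine (phi : R -> R) (l : R) : Prop :=
  exists s : seq R,
    [/\ path <%R 0 s, last 0 s = l &
        forall i, (i < size s)%N -> affine_on phi (nth 0 (0 :: s) i) (nth 0 s i)].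

(* f is continuous on G as soon as it is so along every closed edge, since the
   ends of the edges are glued in [curve_point]. *)
Definition rational_function (f : curve_point -> R) : Prop :=
  forall e, piecewise_affine (fun x => f (edge_point e x)) (len e).

(* The outgoing slope at p along h: the m such that f (p + t h) = f p + m t
   for all small t >= 0. *)
Definition slope (f : curve_point -> R) (p : curve_point) (h : half_edge) : int :=
  xget 0 [set m : int | exists2 eps : R, 0 < eps &
            forall t, 0 <= t < eps -> f (travel p h t) = f p + m%:~R * t]%classic.

Definition divisor := {freeg curve_point / int}.

(* The coefficient of div(f) at p. *)
Definition div_coeff (f : curve_point -> R) (p : curve_point) : int :=
  - \sum_(h in tangent p) slope f p h.

Definition effective (D : divisor) : Prop := forall p, 0 <= coeff p D.

Definition lin_equiv (D E : divisor) : Prop :=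
  exists2 f, rational_function f & forall p, coeff p (D - E) = div_coeff f p.

Definition rank_candidate (D : divisor) (k : int) : Prop :=
  k = -1 \/
  exists2 n : nat, k = n%:Z & forall q : n.-tuple curve_point,
    exists2 E, effective E & lin_equiv (D - \sum_(i < n) << tnth q i >>) E.

(* The maximum of the set of candidates (which is bounded above by
   max(-1, deg D), so that it has one). *)
Definition rank (D : divisor) : int :=
  xget (-1) [set k : int | rank_candidate D k /\
               forall j, rank_candidate D j -> j <= k]%classic.

(* All points but the vertices have valence 2. *)
Definition canonical_divisor : divisor :=
  \sum_(v : vertex G) << ((valence (vtx v))%:Z - 2) *g vtx v >>.

Definition is_gap (D : divisor) (p : curve_point) (m : nat) : Prop :=
  (0 < m)%N /\ rank (D - << p >> *+ m) < rank (D - << p >> *+ m.-1).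

(* The increasing enumeration of the (finite) set of gaps. *)
Definition gap_seq (D : divisor) (p : curve_point) : seq nat :=
  xget [::] [set n : seq nat | sorted ltn n /\
               forall m, m \in n <-> is_gap D p m]%classic.

(* Gaps are 0-indexed here: the i-th entry is n_(i+1), and absz (rank D + 1) is
   r + 1, as rank D >= -1. *)
Definition weight (D : divisor) (p : curve_point) : int :=
  \sum_(i < absz (rank D + 1)) ((nth 0%N (gap_seq D p) i)%:Z - i.+1%:Z).

End TropicalCurve.

Arguments canonical_divisor {R} G.

(* Main.v *)
Require Import Defs.
From mathcomp Require Import all_boot all_order all_algebra.
From mathcomp Require Import freeg.
From mathcomp Require Import boolp classical_sets reals.
From mathcomp Require Import ring lra zify.

(** The theorem reduces to the inequality [rank D + 1 <= clifford_bound (deg D)],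
    i.e. to Clifford's inequality, and hence to Riemann-Roch on metric graphs:
    the weight is [\sum_(m <= d) (rank (D - m p) + 1)] minus a triangular number.
    Both bounds are attained at the vertex [p] of a rose with [g] petals, where
    [2 p ~ x + x'] for every [x] and its mirror image [x'] on the same petal.

    Riemann-Roch follows the Baker-Norine strategy.  For a divisor [D] that is
    nonnegative off a vertex [q], the functions [f <= 0] with [f q = 0] and
    [D + div f >= 0] off [q] have slopes bounded by the number of chips, and their
    pointwise infimum is again such a function, because on an edge [f] is a fixed
    function plus a concave one.  The infimum gives the [q]-reduced divisor [D'].
    If [D' q < 0], burning the graph from [q] shows that [D'] is dominated by the
    divisor of an acyclic orientation; that divisor has degree [g - 1], and its
    complement in the canonical divisor is not equivalent to an effective one, as
    one sees where a rational function attains its minimum. *)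

Set Implicit Arguments.
Unset Strict Implicit.
Unset Printing Implicit Defensive.

Import Order.TTheory GRing.Theory Num.Theory.
Local Open Scope ring_scope.

(** * Piecewise affine functions with integer slopes *)

(** Integrality of slopes supplies the missing discreteness: only finitely many slopes occur, and an
    integer slope larger than [s - 1] is at least [s]. The constants arise as follows. The Clifford
    values floor(e/2) + 1 for e from 0 to 2g - 2 sum to g^2. For the canonical divisor there are g
    gaps, so g(g+1)/2 is subtracted and g(g-1)/2 remains. In degrees e > 2g - 2 the value is e - g +
    1, which runs through g, g + 1, ...; these terms cancel against the triangular number except for
    its first g - 1 terms, which leaves g^2 - g(g-1)/2 = g(g+1)/2 whatever the degree. *)

Section PiecewiseAffine.
Context (R : realType).
Implicit Types (phi psi : R -> R) (x y l c : R) (b : bool) (m : int).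

(* The slope in direction [b]: for [b = false] it is the one seen when moving to
   the left, i.e. minus the left derivative. *)
Definition has_slope phi x b m :=
  exists2 eps : R, 0 < eps & forall t, 0 <= t < eps ->
    phi (if b then x + t else x - t) = phi x + m%:~R * t.

Definition pwl phi l := forall x b,
  (if b then 0 <= x < l else 0 < x <= l) -> exists m, has_slope phi x b m.

Lemma has_slope_uniq phi x b m m' :
  has_slope phi x b m -> has_slope phi x b m' -> m = m'.
Proof.
move=> [e e0 H] [e' e'0 H'].
have t0 : 0 < Num.min e e' / 2 by rewrite divr_gt0 ?ltr0n // lt_min e0.
set t := _ / 2 in t0.
have te : t < e by rewrite /t; case: (leP e e') => h; lra.
have te' : t < e' by rewrite /t; case: (leP e e') => h; lra.
have /H : 0 <= t < e by rewrite ltW.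
rewrite H' ?(ltW t0) // => /addrI /(mulIf (lt0r_neq0 t0)) /intr_inj //.
Qed.

Lemma has_slopeD phi psi x b m n :
  has_slope phi x b m -> has_slope psi x b n ->
  has_slope (fun y => phi y + psi y) x b (m + n).
Proof.
move=> [e e0 H] [e' e'0 H']; exists (Num.min e e'); first by rewrite lt_min e0.
move=> t /andP[t0]; rewrite lt_min => /andP[te te'].
by rewrite H ?t0 // H' ?t0 // intrD mulrDl addrACA.
Qed.

Lemma has_slopeN phi x b m :
  has_slope phi x b m -> has_slope (fun y => - phi y) x b (- m).
Proof.
move=> [e e0 H]; exists e => // t /H ->.
by rewrite opprD mulrNz mulNr.
Qed.

Lemma has_slopeZ phi x b m n :
  has_slope phi x b m -> has_slope (fun y => n%:~R * phi y) x b (n * m).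
Proof.
move=> [e e0 H]; exists e => // t /H ->.
by rewrite intrM mulrDr mulrA.
Qed.

Lemma has_slope_affine c m x b :
  has_slope (fun y => c + m%:~R * y) x b (if b then m else - m).
Proof. by exists 1 => // t _; case: b; rewrite ?mulrNz; ring. Qed.

Lemma has_slope_cst c x b : has_slope (fun=> c) x b 0.
Proof. by exists 1 => // t _; rewrite mul0r addr0. Qed.

Lemma has_slope_sum (I : Type) (r : seq I) (F : I -> R -> R) x b (n : I -> int) :
  (forall i, has_slope (F i) x b (n i)) ->
  has_slope (fun y => \sum_(i <- r) F i y) x b (\sum_(i <- r) n i).
Proof.
move=> H; elim: r => [|i r IH].
  exists 1 => // t _; rewrite !big_nil; ring.
have [e e0 He] := has_slopeD (H i) IH.
by exists e => // t /He; rewrite !big_cons.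
Qed.

Lemma has_slope_min phi psi x b m n :
  has_slope phi x b m -> has_slope psi x b n ->
  has_slope (fun y => Num.min (phi y) (psi y)) x b
    (if phi x < psi x then m else if psi x < phi x then n else Num.min m n).
Proof.
have near (k d : R) : 0 < d ->
    exists2 e, 0 < e & forall t, 0 <= t < e -> k * t < d.
  move=> d0; exists (d / (`|k| + 1)).
    by rewrite divr_gt0 // ltr_wpDl.
  move=> t /andP[t0]; rewrite ltr_pdivlMr ?ltr_wpDl // => h.
  apply: le_lt_trans h; rewrite mulrC ler_wpM2l //.
  by apply: le_trans (ler_norm _) _; rewrite lerDl.
move=> [e e0 H] [e' e'0 H'].
have E t : 0 <= t < Num.min e e' ->
    (phi (if b then x + t else x - t) = phi x + m%:~R * t) /\
    (psi (if b then x + t else x - t) = psi x + n%:~R * t).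
  by rewrite lt_min => /and3P[t0 te te']; rewrite H ?H' ?t0.
have m0 : 0 < Num.min e e' by rewrite lt_min e0.
case: ltgtP => h.
- have [|e1 e10 He1] := near (m%:~R - n%:~R) (psi x - phi x).
    by rewrite subr_gt0.
  exists (Num.min e1 (Num.min e e')); first by rewrite lt_min e10.
  move=> t; rewrite lt_min => /and3P[t0 t1 t2].
  have [|-> ->] := E t; first by rewrite t0.
  have := He1 t; rewrite t0 t1 => /(_ isT); rewrite mulrBl => ?.
  by rewrite !min_l //; lra.
- have [|e1 e10 He1] := near (n%:~R - m%:~R) (phi x - psi x).
    by rewrite subr_gt0.
  exists (Num.min e1 (Num.min e e')); first by rewrite lt_min e10.
  move=> t; rewrite lt_min => /and3P[t0 t1 t2].
  have [|-> ->] := E t; first by rewrite t0.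
  have := He1 t; rewrite t0 t1 => /(_ isT); rewrite mulrBl => ?.
  by rewrite !min_r //; lra.
- exists (Num.min e e') => // t te.
  have [-> ->] := E t te; rewrite -h minxx -addr_minr; congr (_ + _).
  have t0 : 0 <= t by case/andP: te.
  case: (leP m n) => mn; first by rewrite min_l // ler_wpM2r // ler_int.
  by rewrite min_r // ler_wpM2r // ler_int ltW.
Qed.

Definition hinge c x := Num.max 0 (x - c).

Variant hinge_spec c x : R -> Type :=
  | HingeGe of c <= x : hinge_spec c x (x - c)
  | HingeLt of x < c : hinge_spec c x 0.

Lemma hingeP c x : hinge_spec c x (hinge c x).
Proof.
rewrite /hinge; have [cx|cx] := leP c x.
  by rewrite max_r ?subr_ge0 //; constructor.
by rewrite max_l; [constructor|lra].
Qed.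

Lemma has_slope_hinge c x b :
  has_slope (hinge c) x b (if b then (c <= x)%R%:R else - (c < x)%R%:R).
Proof.
rewrite /hinge; case: b; case: ltgtP => h /=.
- exists 1 => // t /andP[t0 _]; rewrite !max_r; [ring|lra|lra].
- exists (c - x); first by rewrite subr_gt0.
  by move=> t /andP[t0 tx]; rewrite !max_l ?mul0r ?addr0 //; lra.
- by exists 1 => // t /andP[t0 _]; rewrite h !max_r; [ring|lra|lra].
- exists (x - c); first by rewrite subr_gt0.
  by move=> t /andP[t0 tx]; rewrite !max_r ?mulrN1z ; [ring|lra|lra].
- by exists 1 => // t /andP[t0 _]; rewrite !max_l ?mul0r ?addr0 //; lra.
- by exists 1 => // t /andP[t0 _]; rewrite !max_l ?mul0r ?addr0 //; lra.
Qed.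

Lemma has_slope_ext phi psi l x b m :
  (forall y, 0 <= y <= l -> phi y = psi y) ->
  (if b then 0 <= x < l else 0 < x <= l) ->
  has_slope phi x b m -> has_slope psi x b m.
Proof.
move=> E xl [e e0 H].
have d0 : 0 < (if b then l - x else x) by case: b xl {H} => /andP[]; lra.
exists (Num.min e (if b then l - x else x)); first by rewrite lt_min e0.
move=> t; rewrite lt_min => /and3P[t0 te td].
have ht := H t; rewrite t0 te in ht.
rewrite -!E; first exact: ht.
  by case: b xl td {d0 H ht} => /= /andP[? ?] _; apply/andP; split; lra.
by case: b xl td {d0 H ht} => /= /andP[? ?] ?; apply/andP; split; lra.
Qed.

Lemma pwl_ext phi psi l :
  (forall y, 0 <= y <= l -> phi y = psi y) -> pwl phi l -> pwl psi l.
Proof. by move=> E H x b xl; have [m Hm] := H x b xl; exists m; apply: (has_slope_ext E xl Hm). Qed.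

Lemma piecewise_affine_ge0 phi l : piecewise_affine phi l -> 0 <= l.
Proof.
move=> [s [ps <- _]]; case: s ps => // a s ps.
have /allP h := order_path_min (@lt_trans _ _) ps.
by rewrite ltW // h //= mem_last.
Qed.

Lemma piecewise_affine_ind phi (P : R -> Prop) :
  P 0 -> (forall y z, 0 <= y < z -> P y -> affine_on phi y z -> P z) ->
  forall l, piecewise_affine phi l -> P l.
Proof.
move=> P0 PS l [s []].
elim/last_ind: s l => [|s z IH] l /=; first by move=> _ <-.
rewrite rcons_path last_rcons => /andP[ps lz] <- H.
have HH i : (i < size s)%N -> affine_on phi (nth 0 (0 :: s) i) (nth 0 s i).
  move=> i_s; have := H i; rewrite size_rcons ltnS (ltnW i_s) => /(_ isT).
  rewrite nth_rcons i_s; case: i i_s => [|i] //= i_s.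
  by rewrite nth_rcons (ltnW i_s).
apply: (PS (last 0 s)).
- rewrite lz andbT; apply: (@piecewise_affine_ge0 phi).
  by exists s; split.
- exact: IH.
- have := H (size s); rewrite size_rcons ltnSn => /(_ isT).
  rewrite nth_rcons ltnn eqxx; congr (affine_on _ _ _).
  by rewrite -rcons_cons nth_rcons /= ltnSn (last_nth 0).
Qed.

Lemma piecewise_affine0 phi : piecewise_affine phi 0.
Proof. by exists [::]. Qed.

Lemma piecewise_affineS phi y z :
  y < z -> piecewise_affine phi y -> affine_on phi y z -> piecewise_affine phi z.
Proof.
move=> yz [s [ps ly H]] A; exists (rcons s z); split.
- by rewrite rcons_path ps ly.
- by rewrite last_rcons.
- move=> i; rewrite size_rcons ltnS leq_eqVlt => /orP[/eqP -> |i_s].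
    rewrite nth_rcons ltnn eqxx; move: A; rewrite -ly; congr (affine_on _ _ _).
    by rewrite -rcons_cons nth_rcons /= ltnSn (last_nth 0).
  rewrite nth_rcons i_s; have := H i i_s.
  by case: i i_s => [|i] //= i_s; rewrite nth_rcons (ltnW i_s).
Qed.

(** An affine piece is minimal at one of its ends, so the breakpoints suffice. This yields minima on
    the whole curve without any topology on [curve_point]. *)
Lemma piecewise_affine_min phi l : piecewise_affine phi l ->
  exists2 s : seq R, all (fun y => 0 <= y <= l) s &
    forall x, 0 <= x <= l -> exists2 y, y \in s & phi y <= phi x.
Proof.
elim/piecewise_affine_ind => {l} [|y z /andP[y0 yz] [s sl H] [m A]].
  exists [:: 0]; first by rewrite /= lexx.
  by move=> x x0; exists 0; rewrite ?mem_head //; have -> : x = 0 by lra.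
exists (z :: s).
  rewrite /= lexx andbT; apply/andP; split; first by lra.
  by apply: sub_all sl => u; lra.
move=> x /andP[x0 xz]; have [xy|xy] := leP x y.
  have [|u us Hu] := H x; first by rewrite x0.
  by exists u => //; rewrite inE us orbT.
have [m0|m0] := leP 0 m.
  have [|u us Hu] := H y; first by rewrite y0 lexx.
  exists u; first by rewrite inE us orbT.
  apply: le_trans Hu _; rewrite (A x) ?(ltW xy) // lerDl.
  by rewrite mulr_ge0 ?ler0z // subr_ge0 ltW.
exists z; first exact: mem_head.
rewrite (A x) ?(A z) ?lexx ?(ltW xy) ?(ltW yz) // lerD2l.
by rewrite ler_wnM2l ?lerD2r // lerz0 ltW.
Qed.

(** The coefficient of the hinge at [c] is the change of slope at [c], i.e. minus the coefficient of
    the divisor there; this normal form is what allows a function to be recovered from its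
    divisor. *)
Lemma piecewise_affine_hinges phi l : piecewise_affine phi l ->
  exists m, exists2 L : seq (R * int), all (fun u => 0 < u.1 < l) L &
    forall x, 0 <= x <= l ->
      phi x = phi 0 + m%:~R * x + \sum_(u <- L) u.2%:~R * hinge u.1 x.
Proof.
elim/piecewise_affine_ind => {l} [|y z /andP[y0 yz] [m [L sL H]] [n A]].
  exists 0; exists [::] => // x x0; have -> : x = 0 by lra.
  by rewrite big_nil mulr0 !addr0.
have sL' : all (fun u => 0 < u.1 < z) L by apply: sub_all sL => v; lra.
have [y00|yn0] := eqVneq y 0.
  exists n; exists [::] => // x xz.
  by rewrite big_nil addr0 (A x) y00 ?subr0.
exists m; exists (rcons L (y, n - m - \sum_(u <- L) u.2)) => [|x /andP[x0 xz]].
  by rewrite all_rcons sL' andbT /= lt0r yn0 y0.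
rewrite -cats1 big_cat big_seq1 /=.
have [xy|xy] := leP x y.
  by rewrite H ?x0 // /hinge [Num.max 0 (x - y)]max_l ?mulr0 ?addr0 // subr_le0.
rewrite (A x) ?(ltW xy) // H ?y0 ?lexx // {3}/hinge [Num.max 0 (x - y)]max_r; last lra.
have -> : \sum_(u <- L) u.2%:~R * hinge u.1 x =
    \sum_(u <- L) u.2%:~R * hinge u.1 y + (\sum_(u <- L) u.2)%:~R * (x - y).
  rewrite raddf_sum mulr_suml -big_split /=.
  rewrite !big_seq; apply: eq_bigr => u uL.
  have := allP sL u uL => /andP[c0 cy].
  by rewrite /hinge !max_r; [ring|lra|lra].
by rewrite !intrB; ring.
Qed.

(** Compactness of [0, l] in the form of a supremum [s] of the ends up to which [phi] is piecewise
    affine: the left germ at [s] shows that [s] itself is reached, and the right germ would lead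
    beyond [s] if [s < l]. *)
Lemma pwl_piecewise_affine phi l : 0 < l -> pwl phi l -> piecewise_affine phi l.
Proof.
move=> l0 H.
pose A := [set y | 0 <= y <= l /\ piecewise_affine phi y]%classic.
have A0 : A 0 by split; [rewrite lexx ltW|exact: piecewise_affine0].
have supA : has_sup A.
  by split; [exists 0|exists l => y [/andP[]]].
set s := sup A.
have s0 : 0 <= s by apply: ub_le_sup => //; case: supA.
have sl : s <= l by apply: ge_sup => [|y [/andP[]]]; [exists 0|].
have As : A s.
  have [s00|sn0] := eqVneq s 0; first by rewrite s00.
  have [|m [e e0 E]] := H s false; first by rewrite lt0r sn0 s0.
  have [y [y0l py] ys] := sup_adherent e0 supA.
  have [<- //|ny] := eqVneq y s.
  have lys : y < s by rewrite lt_neqAle ny; apply: ub_le_sup => //; case: supA.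
  split; first by rewrite s0.
  apply: piecewise_affineS lys py _; exists (- m) => x /andP[yx xs].
  have E' u : y <= u <= s -> phi u = phi s + m%:~R * (s - u).
    move=> /andP[yu us]; rewrite -E; first by congr phi; ring.
    by rewrite -/s in ys; apply/andP; split; lra.
  rewrite (E' x) ?yx // (E' y); first by rewrite mulrNz; ring.
  by apply/andP; split; lra.
have [<-|sn] := eqVneq s l; first by case: As.
have sll : s < l by rewrite lt_neqAle sn.
have [|m [e e0 E]] := H s true; first by rewrite s0.
pose d := Num.min (e / 2) (l - s).
have d0 : 0 < d by rewrite lt_min divr_gt0 ?subr_gt0.
have : A (s + d).
  have dl : d <= l - s by rewrite ge_min lexx orbT.
  have de : d <= e / 2 by rewrite ge_min lexx.
  split; first by apply/andP; split; lra.
  apply: (@piecewise_affineS _ s); [by rewrite ltrDl|by case: As|].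
  exists m => x /andP[sx xd]; rewrite -E; first by congr phi; ring.
  by apply/andP; split; lra.
move=> /(ub_le_sup supA.2); rewrite -/s; lra.
Qed.

Lemma pwlD phi psi l : pwl phi l -> pwl psi l -> pwl (fun y => phi y + psi y) l.
Proof.
move=> H K x b xl; have [m Hm] := H x b xl; have [n Kn] := K x b xl.
by exists (m + n); apply: has_slopeD.
Qed.

Lemma pwl_min phi psi l :
  pwl phi l -> pwl psi l -> pwl (fun y => Num.min (phi y) (psi y)) l.
Proof.
move=> H K x b xl; have [m Hm] := H x b xl; have [n Kn] := K x b xl.
by eexists; apply: has_slope_min Hm Kn.
Qed.

Lemma pwl_hinges m c (I : Type) (L : seq I) (a : I -> R) (n : I -> int) l :
  pwl (fun x => c + m%:~R * x + \sum_(i <- L) (n i)%:~R * hinge (a i) x) l.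
Proof.
move=> x b _; eexists; apply: has_slopeD; first exact: has_slope_affine.
by apply: has_slope_sum => i; apply/has_slopeZ/has_slope_hinge.
Qed.

Lemma piecewise_affine_pwl phi l : piecewise_affine phi l -> pwl phi l.
Proof.
move=> /piecewise_affine_hinges[m [L _ H]].
by apply: pwl_ext (fun y yl => esym (H y yl)) _; apply: pwl_hinges.
Qed.

End PiecewiseAffine.

(** * Additive evaluation of divisors against weights on points *)

Section Evaluation.
Context (K : choiceType) (A : zmodType).
Implicit Types (w : K -> A) (D : {freeg K / int}).

(** The degree, a coefficient, the number of chips on part of an edge and the function [psi] are all
    of this form, so additivity and positivity are proved once for all of them. *)
Definition ev w D : A := \sum_(p <- dom D) w p *~ coeff p D.

Lemma evE w s D : uniq s -> {subset dom D <= s} ->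
  ev w D = \sum_(p <- s) w p *~ coeff p D.
Proof.
move=> us sD; rewrite [RHS](bigID (mem (dom D))) /= [X in _ + X]big1 ?addr0.
  rewrite -[RHS]big_filter; apply: perm_big; apply: uniq_perm.
  - exact: uniq_dom.
  - exact: filter_uniq.
  - by move=> p; rewrite mem_filter /= andb_idr //; apply: sD.
by move=> p /coeff_outdom ->.
Qed.

Lemma evD w D E : ev w (D + E) = ev w D + ev w E.
Proof.
pose s := undup (dom D ++ dom E ++ dom (D + E)).
have us : uniq s by exact: undup_uniq.
rewrite !(@evE w s) //; try by move=> p; rewrite mem_undup !mem_cat => ->; rewrite ?orbT.
by rewrite -big_split /=; apply: eq_bigr => p _; rewrite coeffD mulrzDr.
Qed.

Lemma ev0 w : ev w 0 = 0.
Proof. by rewrite /ev dom0 big_nil. Qed.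

Lemma evN w D : ev w (- D) = - ev w D.
Proof. by apply/eqP; rewrite -addr_eq0 -evD addNr ev0. Qed.

Lemma evB w D E : ev w (D - E) = ev w D - ev w E.
Proof. by rewrite evD evN. Qed.

Lemma evU w k p : ev w << k *g p >> = w p *~ k.
Proof.
have [->|k0] := eqVneq k 0; first by rewrite freegU0 ev0 mulr0z.
by rewrite /ev domU // big_seq1 coeffU eqxx mulr1.
Qed.

Lemma ev_sum w (I : Type) (r : seq I) (P : pred I) (F : I -> {freeg K / int}) :
  ev w (\sum_(i <- r | P i) F i) = \sum_(i <- r | P i) ev w (F i).
Proof. exact: (big_morph (ev w) (evD w) (ev0 w)). Qed.

Lemma evDl w w' D : ev (fun p => w p + w' p) D = ev w D + ev w' D.
Proof. by rewrite /ev -big_split; apply: eq_bigr => p _; rewrite mulrzDl. Qed.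

Lemma evNl w D : ev (fun p => - w p) D = - ev w D.
Proof. by rewrite /ev -sumrN; apply: eq_bigr => p _; rewrite mulNrz. Qed.

Lemma ev_suml (I : Type) (r : seq I) (P : pred I) (w : I -> K -> A) D :
  ev (fun p => \sum_(i <- r | P i) w i p) D = \sum_(i <- r | P i) ev (w i) D.
Proof.
rewrite /ev exchange_big; apply: eq_bigr => p _.
by rewrite mulrz_suml.
Qed.

Lemma eq_ev w w' D : (forall p, coeff p D != 0 -> w p = w' p) -> ev w D = ev w' D.
Proof.
move=> H; rewrite /ev !big_seq; apply: eq_bigr => p.
by rewrite mem_dom => /H ->.
Qed.

Lemma ev_coeff0 w D : (forall p, coeff p D != 0 -> w p = 0) -> ev w D = 0.
Proof.
move=> H; rewrite /ev big_seq big1 // => p.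
by rewrite mem_dom => /H ->; rewrite mul0rz.
Qed.

Lemma eq_evr w D E : (forall p, w p != 0 -> coeff p D = coeff p E) -> ev w D = ev w E.
Proof.
move=> H; apply/eqP; rewrite -subr_eq0 -evB; apply/eqP/ev_coeff0 => p.
rewrite coeffB subr_eq0 => n; apply/eqP; apply: contraNT n => /H ->; exact: eqxx.
Qed.
End Evaluation.

Lemma ev_ge0 (K : choiceType) (A : numDomainType) (w : K -> A) (D : {freeg K / int}) :
  (forall p, 0 <= w p) -> (forall p, w p != 0 -> 0 <= coeff p D) -> 0 <= ev w D.
Proof.
move=> w0 H; apply: sumr_ge0 => p _; have [->|/H] := eqVneq (w p) 0.
  by rewrite mul0rz.
by move=> h; rewrite mulrz_ge0.
Qed.

Lemma ev_pred1 (K : choiceType) p (D : {freeg K / int}) :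
  ev (fun q => (q == p)%:Z) D = coeff p D.
Proof.
rewrite /ev; have [pD|pD] := boolP (p \in dom D).
  rewrite (bigD1_seq p) ?uniq_dom //= eqxx big1 ?addr0 ?mulrz_int // => [|q /negPf ->].
    by rewrite -mulrzr mul1r intz.
  by rewrite mul0rz.
rewrite coeff_outdom // big_seq big1 // => q qD.
by have -> : q == p = false; [apply: contraNF pD => /eqP <-|rewrite mul0rz].
Qed.

Lemma deg_ev (K : choiceType) (D : {freeg K / int}) : deg D = ev (fun=> 1) D.
Proof.
rewrite -{1}(freeg_sumE D) raddf_sum; apply: eq_bigr => p _ /=.
by rewrite degU -mulrzr mul1r intz.
Qed.

Lemma freegP (K : choiceType) (D E : {freeg K / int}) :
  (forall p, coeff p D = coeff p E) -> D = E.
Proof. by move=> H; apply/eqP/freeg_eqP. Qed.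

Ltac freeg_ring := apply: freegP => ?; rewrite !(coeffD, coeffN, coeffMn, coeff0); ring.

(** * Divisors of rational functions *)

Section Potentials.
Context (R : realType) (G : tropical_curve R).
Implicit Types (P Q : pred R) (D E : divisor G) (e : edge G) (h : half_edge G) (v : vertex G).
Implicit Types (p q : curve_point G) (f : curve_point G -> R) (m : edge G -> int).

Lemma edge_point0 e : edge_point e 0 = vtx (src e).
Proof.
rewrite /edge_point lexx /insubd insubF //.
by rewrite /is_point ltxx.
Qed.

Lemma edge_point_len e : edge_point e (len e) = vtx (tgt e).
Proof.
rewrite /edge_point leNgt len_gt0 /= /insubd insubF //.
by rewrite /is_point ltxx andbF.
Qed.

Lemma edge_point_val e a : 0 < a < len e -> point_val (edge_point e a) = inr (e, a).
Proof. by move=> H; apply: (@insubdK _ _ (curve_point G) (vtx _) (inr (e, a)) H). Qed.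

Lemma point_val_inj : injective (@point_val R G).
Proof. exact: val_inj. Qed.

Variant point_spec : curve_point G -> Type :=
  | VertexPoint v : point_spec (vtx v)
  | EdgePoint e a of 0 < a < len e : point_spec (edge_point e a).

Lemma pointP p : point_spec p.
Proof.
case E: (point_val p) => [v|[e a]].
  by have -> : p = vtx v; [apply: point_val_inj; rewrite E|constructor].
have H : 0 < a < len e by have := valP p; rewrite -[val p]/(point_val p) E.
by have -> : p = edge_point e a; [apply: point_val_inj; rewrite edge_point_val|constructor].
Qed.

Lemma vtx_inj : injective (@vtx R G).
Proof. by move=> u v /(congr1 (@point_val R G)) []. Qed.

Lemma vtx_neq_edge_point v e a : 0 < a < len e -> (vtx v == edge_point e a) = false.
Proof.
move=> H; apply/eqP => /(congr1 (@point_val R G)).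
by rewrite edge_point_val.
Qed.

Lemma edge_point_eq e a e' a' : 0 < a < len e -> 0 < a' < len e' ->
  (edge_point e a == edge_point e' a') = (e == e') && (a == a').
Proof.
move=> H H'; apply/eqP/andP => [|[/eqP -> /eqP -> //]].
by move/(congr1 (@point_val R G)); rewrite !edge_point_val // => -[-> ->].
Qed.

Definition on_edge e (P : pred R) p : bool :=
  if point_val p is inr (e', a) then (e' == e) && P a else false.

Lemma on_edge_vtx e P v : on_edge e P (vtx v) = false.
Proof. by []. Qed.

Lemma on_edge_edge_point e P e' a : 0 < a < len e' ->
  on_edge e P (edge_point e' a) = (e' == e) && P a.
Proof. by move=> H; rewrite /on_edge edge_point_val. Qed.

Definition csum D e (P : pred R) : int := ev (fun p => (on_edge e P p)%:Z) D.

Definition hinge_at e x p : R :=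
  if point_val p is inr (e', a) then (if e' == e then hinge a x else 0) else 0.

(** A second antiderivative of the chips inside [e]: it vanishes at 0, starts with slope 0, and its
    slope grows by the coefficient of [D] at each interior point. Hence [- psi D e] has divisor [D]
    in the interior of [e]. *)
Definition psi D e x : R := ev (hinge_at e x) D.

Lemma csumD D E e P : csum (D + E) e P = csum D e P + csum E e P.
Proof. exact: evD. Qed.
Lemma csumN D e P : csum (- D) e P = - csum D e P.
Proof. exact: evN. Qed.
Lemma psiD D E e x : psi (D + E) e x = psi D e x + psi E e x.
Proof. exact: evD. Qed.
Lemma psiN D e x : psi (- D) e x = - psi D e x.
Proof. exact: evN. Qed.

Lemma csum_vtx k v e P : csum << k *g vtx v >> e P = 0.
Proof. by rewrite /csum evU on_edge_vtx mul0rz. Qed.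

Lemma csumU k e' a e P : 0 < a < len e' ->
  csum << k *g edge_point e' a >> e P = if (e' == e) && P a then k else 0.
Proof.
move=> H; rewrite /csum evU on_edge_edge_point //.
by case: ifP => _; rewrite ?mul0rz // -mulrzr mul1r intz.
Qed.
Lemma psiU k e' a e x : 0 < a < len e' ->
  psi << k *g edge_point e' a >> e x = if e' == e then k%:~R * hinge a x else 0.
Proof.
move=> H; rewrite /psi evU /hinge_at edge_point_val //.
by case: ifP => _; rewrite ?mul0rz // -mulrzr mulrC.
Qed.

Lemma csum_none D e P : (forall a, 0 < a < len e -> ~~ P a) -> csum D e P = 0.
Proof.
move=> H; apply: ev_coeff0 => p _; case: (pointP p) => [v|e' a ae] //=.
rewrite on_edge_edge_point //; have [E|//] := eqVneq e' e.
by subst e'; rewrite (negPf (H a ae)).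
Qed.

Lemma eq_csum D e (P Q : pred R) :
  (forall a, 0 < a < len e -> P a = Q a) -> csum D e P = csum D e Q.
Proof.
move=> H; apply: eq_ev => p _; case: (pointP p) => [v|e' a ae] //.
rewrite !on_edge_edge_point //; have [E|//] := eqVneq e' e.
by subst e'; rewrite H.
Qed.

Lemma csum_ge0 D e P :
  (forall a, 0 < a < len e -> P a -> 0 <= coeff (edge_point e a) D) -> 0 <= csum D e P.
Proof.
move=> H; apply: ev_ge0 => // p; case: (pointP p) => [v|e' a ae] //.
rewrite !on_edge_edge_point //; have [E|//] := eqVneq e' e.
by subst e'; case Pa: (P a) => // _; apply: H.
Qed.

Lemma csum_split D e (P Q : pred R) :
  csum D e P = csum D e (fun a => P a && Q a) + csum D e (fun a => P a && ~~ Q a).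
Proof.
rewrite /csum -evDl; apply: eq_ev => p _; case: (pointP p) => [v|e' a ae] //.
by rewrite !on_edge_edge_point //; case: (e' == e) (P a) (Q a) => [] [] [].
Qed.

Lemma csum1 D e a : 0 < a < len e -> csum D e (pred1 a) = coeff (edge_point e a) D.
Proof.
move=> ae; rewrite -ev_pred1; apply: eq_ev => p _; case: (pointP p) => [v|e' b be].
  by rewrite on_edge_vtx vtx_neq_edge_point.
by rewrite on_edge_edge_point // edge_point_eq.
Qed.

Lemma eq_csumr D E e P :
  (forall a, 0 < a < len e -> P a -> coeff (edge_point e a) D = coeff (edge_point e a) E) ->
  csum D e P = csum E e P.
Proof.
move=> H; apply: eq_evr => p; case: (pointP p) => [v|e' a ae] //.
rewrite !on_edge_edge_point //; have [E0|//] := eqVneq e' e.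
by subst e'; case Pa: (P a) => // _; apply: H.
Qed.

Lemma eq_psi D E e x :
  (forall a, 0 < a < len e -> coeff (edge_point e a) D = coeff (edge_point e a) E) ->
  psi D e x = psi E e x.
Proof.
move=> H; apply: eq_evr => p; case: (pointP p) => [v|e' a ae] //; first by rewrite eqxx.
rewrite /hinge_at edge_point_val //; have [E0|] := eqVneq e' e; last by rewrite eqxx.
by subst e' => _; apply: H.
Qed.

Definition mass D e := csum D e predT.

Lemma psi_pwl D e x b :
  has_slope (psi D e) x b
    (if b then csum D e (fun a => a <= x)%R else - csum D e (fun a => a < x)%R).
Proof.
have H p : has_slope (fun y => (coeff p D)%:~R * hinge_at e y p) x b
    (coeff p D * (if b then (on_edge e (fun a => a <= x)%R p)%:Z
                  else - (on_edge e (fun a => a < x)%R p)%:Z)).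
  apply: has_slopeZ; case: (pointP p) => [v|e' a ae].
    by rewrite !on_edge_vtx; case: b; apply: has_slope_cst.
  rewrite /hinge_at edge_point_val // !on_edge_edge_point //.
  case: (e' == e) => /=; last by rewrite oppr0 if_same; exact: has_slope_cst.
  by have := has_slope_hinge a x b; rewrite !natz.
have := has_slope_sum (dom D) H.
set n := \sum_(_ <- _) _; set n' := if b then _ else _ => -[d d0 K].
have <- : n = n'.
  rewrite /n /n'; case: b {H K n n'}; last rewrite -sumrN.
    by apply: eq_bigr => p _; rewrite mulrC -mulrzr intz.
  by apply: eq_bigr => p _; rewrite mulrN mulrC -mulrzr intz.
exists d => // t /K; rewrite /psi /ev => E.
rewrite (eq_bigr _ (fun p _ => esym (mulrzl _ _))) E; congr (_ + _).
by apply: eq_bigr => p _; rewrite mulrzl.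
Qed.

Lemma psi0 D e : psi D e 0 = 0.
Proof.
apply: ev_coeff0 => p _; case: (pointP p) => [v|e' a ae] //.
rewrite /hinge_at edge_point_val //; case: ifP => // _.
by rewrite /hinge max_l //; case/andP: ae; lra.
Qed.

(* On each edge [f] is recovered from its initial slope [m e] and the interior
   part of its divisor; the vertex coefficients of [D] play no role. *)
Definition integrates f D m := forall e x, 0 <= x <= len e ->
  f (edge_point e x) = f (vtx (src e)) + (m e)%:~R * x - psi D e x.

(** The outgoing slope at the vertex where [h] starts: along [e] the slope ends at [m e - mass D e],
    and the sign changes when the edge is travelled from its far end. *)
Definition outward m D h : int := if h.2 then m h.1 else mass D h.1 - m h.1.

(** A chip lying exactly at [x] bends the function for a traveller to the right but not yet for one
    to the left, hence the weak and the strict inequality. *)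
Definition dir_slope m D e x (b : bool) : int :=
  if b then m e - csum D e (fun a => a <= x) else csum D e (fun a => a < x) - m e.

Lemma tangent_coordinate p h : h \in tangent p ->
  edge_point h.1 (coordinate p h) = p /\
  (if h.2 then 0 <= coordinate p h < len h.1 else 0 < coordinate p h <= len h.1).
Proof.
rewrite /tangent /coordinate; case: (pointP p) => [v|e a ae] /=.
  rewrite inE /origin => /eqP <-; case: h => e [] /=.
    by rewrite edge_point0 lexx len_gt0.
  by rewrite edge_point_len lexx len_gt0.
rewrite edge_point_val // inE; case: h => e' b /= /eqP ->; split=> //.
by case/andP: ae => ? ?; case: b; apply/andP; split => //; apply: ltW.
Qed.

Lemma slopeE f p h k : h \in tangent p ->
  has_slope (fun x => f (edge_point h.1 x)) (coordinate p h) h.2 k -> slope f p h = k.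
Proof.
move=> /tangent_coordinate[pE _] H.
have E n : (exists2 eps : R, 0 < eps &
    forall t, 0 <= t < eps -> f (travel p h t) = f p + n%:~R * t) <->
  has_slope (fun x => f (edge_point h.1 x)) (coordinate p h) h.2 n.
  by rewrite /has_slope pE.
apply: xget_unique => [|n]; first exact/E.
by move/E => /has_slope_uniq -/(_ _ H).
Qed.

Lemma integrates_slope f D m e x b : integrates f D m ->
  (if b then 0 <= x < len e else 0 < x <= len e) ->
  has_slope (fun x => f (edge_point e x)) x b (dir_slope m D e x b).
Proof.
move=> H xe; apply: (has_slope_ext (fun y ye => esym (H e y ye)) xe).
have := has_slopeD (has_slope_affine (f (vtx (src e))) (m e) x b) (has_slopeN (psi_pwl D e x b)).
by congr has_slope; rewrite /dir_slope; case: b {xe}; rewrite ?opprK // addrC.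
Qed.

Lemma integrates_slopeE f D m p h : integrates f D m -> h \in tangent p ->
  slope f p h = dir_slope m D h.1 (coordinate p h) h.2.
Proof.
move=> H hp; apply: slopeE => //; apply: integrates_slope => //.
by case: (tangent_coordinate hp).
Qed.

Lemma slope_vtx f D m v h : integrates f D m -> h \in tangent (vtx v) ->
  slope f (vtx v) h = outward m D h.
Proof.
move=> H hv; rewrite (integrates_slopeE H hv) /coordinate /= /dir_slope /outward.
case: h.2; first by rewrite csum_none ?subr0 // => a /andP[? _]; rewrite -ltNge.
by congr (_ - _); apply: eq_csum => a /andP[_ ->].
Qed.

Lemma tangent_edge e a : 0 < a < len e ->
  tangent (edge_point e a) = [set (e, true); (e, false)]%SET.
Proof.
move=> ae; rewrite /tangent edge_point_val //; apply/setP => -[e' b].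
by rewrite !inE !xpair_eqE; case: b; rewrite ?andbT ?andbF ?orbF.
Qed.

Lemma mem_tangent_edge e a b : 0 < a < len e -> (e, b) \in tangent (edge_point e a).
Proof. by move=> ae; rewrite tangent_edge // !inE !xpair_eqE eqxx; case: b. Qed.

Lemma csum_le D e a : 0 < a < len e ->
  csum D e (fun x => x <= a) = csum D e (fun x => x < a) + coeff (edge_point e a) D.
Proof.
move=> ae; rewrite (csum_split D e (fun x => x <= a) (fun x => x < a)) -csum1 //.
by congr (_ + _); apply: eq_csum => b _ /=; case: ltgtP.
Qed.

Lemma integrates_div_edge f D m e a : integrates f D m -> 0 < a < len e ->
  div_coeff f (edge_point e a) = coeff (edge_point e a) D.
Proof.
move=> H ae; rewrite /div_coeff tangent_edge // big_setU1 ?big_set1 ?inE ?xpair_eqE ?andbF //=.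
rewrite !(integrates_slopeE H (mem_tangent_edge _ ae)) /coordinate edge_point_val // /dir_slope /=.
by rewrite csum_le //; ring.
Qed.

Definition isdiv f D := rational_function f /\ forall p, coeff p D = div_coeff f p.

Lemma rational_integrates f : rational_function f ->
  exists m, exists2 D, integrates f D m & forall v, coeff (vtx v) D = 0.
Proof.
move=> H.
have /choice[c cP] : forall e, exists c : int * seq (R * int),
   all (fun u => 0 < u.1 < len e) c.2 /\
    forall x, 0 <= x <= len e ->
      f (edge_point e x) = f (vtx (src e)) + c.1%:~R * x + \sum_(u <- c.2) u.2%:~R * hinge u.1 x.
  move=> e; have /piecewise_affine_hinges[n [L L0 HL]] := H e.
  by exists (n, L); split => // x xe; rewrite (HL x xe) edge_point0.
exists (fun e => (c e).1).
exists (\sum_e \sum_(u <- (c e).2) << - u.2 *g edge_point e u.1 >>).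
  move=> e x xe; rewrite (cP e).2 // /psi ev_sum (bigD1 e) //= [X in _ - (_ + X)]big1 ?addr0.
    congr (_ + _); rewrite ev_sum -sumrN !big_seq; apply: eq_bigr => u uL.
    have u0 := allP (cP e).1 u uL.
    by have := psiU (- u.2) e x u0; rewrite /psi eqxx => ->; rewrite mulrNz mulNr opprK.
  move=> e' e'e; rewrite ev_sum big_seq big1 // => u uL.
  have u0 := allP (cP e').1 u uL.
  by have := psiU (- u.2) e x u0; rewrite /psi (negPf e'e).
move=> v; rewrite raddf_sum big1 // => e _; rewrite raddf_sum big_seq big1 // => u uL.
have u0 := allP (cP e).1 u uL.
by rewrite /= coeffU eq_sym vtx_neq_edge_point // mulr0.
Qed.

Lemma isdiv_ex f : rational_function f -> exists D, isdiv f D.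
Proof.
move=> H; have [m [D Hm D0]] := rational_integrates H.
exists (D + \sum_v << div_coeff f (vtx v) *g vtx v >>); split=> // p.
rewrite coeffD raddf_sum; case: (pointP p) => [v|e a ae].
  rewrite D0 add0r (bigD1 v) //= coeffU eqxx mulr1 big1 ?addr0 // => u uv.
  by rewrite coeffU (inj_eq vtx_inj) (negPf uv) mulr0.
rewrite (integrates_div_edge Hm) // big1 ?addr0 // => v _.
by rewrite /= coeffU vtx_neq_edge_point ?mulr0.
Qed.

(** The condition on the right is linear in [f], [D] and [m], so sums and opposites are immediate,
    and a function with prescribed divisor can be built by choosing slopes and interior chips. *)
Lemma isdivP f D : isdiv f D <-> exists2 m, integrates f D m &
  forall v, coeff (vtx v) D = - \sum_(h in tangent (vtx v)) outward m D h.
Proof.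
split=> [[rf fD]|[m Hm DV]].
  have [m [D' Hm _]] := rational_integrates rf.
  have HmD : integrates f D m.
    move=> e x xe; rewrite Hm //; congr (_ - _); apply: eq_psi => a ae.
    by rewrite fD (integrates_div_edge Hm).
  exists m => // v; rewrite fD /div_coeff; congr (- _); apply: eq_bigr => h hv.
  exact: slope_vtx HmD hv.
split=> [e|p]; first last.
  case: (pointP p) => [v|e a ae]; last by rewrite (integrates_div_edge Hm).
  rewrite DV /div_coeff; congr (- _); apply: eq_bigr => h hv.
  by rewrite (slope_vtx Hm).
apply: pwl_piecewise_affine; first exact: len_gt0.
by move=> x b xe; eexists; apply: integrates_slope Hm xe.
Qed.

Lemma integratesD f f' D D' m m' : integrates f D m -> integrates f' D' m' ->
  integrates (fun p => f p + f' p) (D + D') (fun e => m e + m' e).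
Proof. by move=> H H' e x xe; rewrite H // H' // psiD intrD; ring. Qed.

Lemma isdivD f f' D D' : isdiv f D -> isdiv f' D' -> isdiv (fun p => f p + f' p) (D + D').
Proof.
move=> /isdivP[m Hm DV] /isdivP[m' Hm' DV']; apply/isdivP.
exists (fun e => m e + m' e); first exact: integratesD.
move=> v; rewrite coeffD DV DV' -opprD -big_split; congr (- _).
by apply: eq_bigr => h _; rewrite /outward /mass csumD; case: h.2 => //=; ring.
Qed.

Lemma isdivN f D : isdiv f D -> isdiv (fun p => - f p) (- D).
Proof.
move=> /isdivP[m Hm DV]; apply/isdivP; exists (fun e => - m e).
  by move=> e x xe; rewrite Hm // psiN intrN; ring.
move=> v; rewrite coeffN DV -sumrN; congr (- _).
by apply: eq_bigr => h _; rewrite /outward /mass csumN; case: h.2 => //=; ring.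
Qed.

Lemma isdiv_cst c : isdiv (fun=> c) 0.
Proof.
apply/isdivP; exists (fun=> 0).
  by move=> e x xe; rewrite /psi ev0; ring.
move=> v; rewrite coeff0 big1 ?oppr0 // => h _.
by rewrite /outward /mass /csum ev0; case: h.2.
Qed.

(** The hypothesis is the gluing condition: integrating along [e] from its source has to end at the
    value prescribed at its target. *)
Lemma integrates_make (phi : vertex G -> R) m D :
  (forall e, phi (tgt e) = phi (src e) + (m e)%:~R * len e - psi D e (len e)) ->
  exists2 f, integrates f D m & forall v, f (vtx v) = phi v.
Proof.
move=> H.
exists (fun p => match point_val p with
                 | inl v => phi v
                 | inr (e, x) => phi (src e) + (m e)%:~R * x - psi D e x end) => //.
move=> e x /andP[]; rewrite le_eqVlt => /predU1P[<- _|x0].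
  by rewrite edge_point0 /= psi0; ring.
rewrite le_eqVlt => /predU1P[->|xe].
  by rewrite edge_point_len /= H.
by rewrite edge_point_val ?x0.
Qed.

Lemma deg_split D : deg D = \sum_v coeff (vtx v) D + \sum_e mass D e.
Proof.
rewrite deg_ev (eq_bigr _ (fun v _ => esym (ev_pred1 (vtx v) D))).
rewrite -!ev_suml -evDl; apply: eq_ev => p _; case: (pointP p) => [v|e a ae].
  rewrite (bigD1 v) //= eqxx !big1 ?addr0 // => u uv.
  by rewrite (inj_eq vtx_inj) eq_sym (negPf uv).
rewrite big1 ?add0r => [|v _]; last by rewrite eq_sym vtx_neq_edge_point.
rewrite (bigD1 e) //= on_edge_edge_point // eqxx big1 // => e' e'e.
by rewrite on_edge_edge_point // eq_sym (negPf e'e).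
Qed.

Lemma sum_tangent (F : half_edge G -> int) :
  \sum_v \sum_(h in tangent (vtx v)) F h = \sum_e (F (e, true) + F (e, false)).
Proof.
transitivity (\sum_h F h).
  rewrite [RHS](partition_big (@origin R G) xpredT) //=.
  by apply: eq_bigr => v _; apply: eq_bigl => h; rewrite /tangent /= inE.
rewrite (eq_bigr (fun h => F (h.1, h.2))); last by case.
rewrite -(pair_bigA _ (fun e b => F (e, b))) /=.
by apply: eq_bigr => e _; rewrite big_bool.
Qed.

(** The outgoing slopes at the two ends of [e] add up to [mass D e], so the vertex coefficients
    cancel the interior chips edge by edge. *)
Lemma isdiv_deg f D : isdiv f D -> deg D = 0.
Proof.
move=> /isdivP[m _ DV]; rewrite deg_split (eq_bigr _ (fun v _ => DV v)).
rewrite sumrN sum_tangent addrC; apply/eqP; rewrite subr_eq0; apply/eqP.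
by apply: eq_bigr => e _; rewrite /outward /=; ring.
Qed.

End Potentials.
Arguments vtx_inj {R G}.

(** * Linear equivalence to effective divisors *)

Section Winnable.
Context (R : realType) (G : tropical_curve R).
Implicit Types (P Q : pred R) (D E : divisor G) (e : edge G) (h : half_edge G) (v : vertex G).
Implicit Types (p q : curve_point G) (f : curve_point G -> R) (m : edge G -> int).

Definition target h : vertex G := origin (h.1, ~~ h.2).

Lemma tangent_vtx h v : (h \in tangent (vtx v)) = (origin h == v).
Proof. by rewrite /tangent /= inE. Qed.

Lemma sum_tangent_vtx v (F : half_edge G -> int) :
  \sum_(h in tangent (vtx v)) F h =
  \sum_e ((if src e == v then F (e, true) else 0) + (if tgt e == v then F (e, false) else 0)).
Proof.
rewrite big_mkcond /= (eq_bigr (fun h => if origin (h.1, h.2) == v then F (h.1, h.2) else 0)).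
  rewrite -(pair_bigA _ (fun e b => if origin (e, b) == v then F (e, b) else 0)) /=.
  by apply: eq_bigr => e _; rewrite big_bool.
by case=> e b _; rewrite tangent_vtx.
Qed.

Section Family.
Variables (n : edge G -> int) (a : edge G -> R).
Hypothesis ae : forall e, 0 < a e < len e.
Let D := \sum_e << n e *g edge_point e (a e) >>.

Lemma psi_family e x : psi D e x = (n e)%:~R * hinge (a e) x.
Proof.
rewrite /psi ev_sum (bigD1 e) //= big1 ?addr0 => [|e' e'e].
  by have := psiU (n e) e x (ae e); rewrite eqxx.
by have := psiU (n e') e x (ae e'); rewrite (negPf e'e).
Qed.

Lemma csum_family e P : csum D e P = if P (a e) then n e else 0.
Proof.
rewrite /csum ev_sum (bigD1 e) //= big1 ?addr0 => [|e' e'e].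
  by have := csumU (n e) e P (ae e); rewrite eqxx.
by have := csumU (n e') e P (ae e'); rewrite (negPf e'e).
Qed.

Lemma coeff_vtx_family v : coeff (vtx v) D = 0.
Proof.
by rewrite raddf_sum big1 // => e _; rewrite /= coeffU eq_sym vtx_neq_edge_point ?mulr0.
Qed.

Lemma coeff_edge_family e b : 0 < b < len e ->
  coeff (edge_point e b) D = if b == a e then n e else 0.
Proof. by move=> be; rewrite -csum1 // csum_family /= eq_sym. Qed.
End Family.

(** Only the interior chips of [D] are free. At the vertices the slopes dictate the divisor, so [D']
    is [D] with its vertex coefficients corrected by [c]. *)
Lemma isdiv_build (phi : vertex G -> R) m D :
  (forall e, phi (tgt e) = phi (src e) + (m e)%:~R * len e - psi D e (len e)) ->
  exists f D', [/\ isdiv f D', integrates f D m, forall v, f (vtx v) = phi v,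
    forall e a, 0 < a < len e -> coeff (edge_point e a) D' = coeff (edge_point e a) D &
    forall v, coeff (vtx v) D' = - \sum_(h in tangent (vtx v)) outward m D h].
Proof.
move=> /integrates_make[f Hf fV]; exists f.
pose c v := - (\sum_(h in tangent (vtx v)) outward m D h) - coeff (vtx v) D.
pose D' := D + \sum_v << c v *g vtx v >>; exists D'.
have cE e a : 0 < a < len e -> coeff (edge_point e a) D' = coeff (edge_point e a) D.
  move=> ae; rewrite coeffD raddf_sum big1 ?addr0 // => v _.
  by rewrite /= coeffU vtx_neq_edge_point ?mulr0.
have cV v : coeff (vtx v) D' = - \sum_(h in tangent (vtx v)) outward m D h.
  rewrite coeffD raddf_sum (bigD1 v) //= coeffU eqxx mulr1 big1 ?addr0 /c.
    by rewrite addrC subrK.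
  by move=> u uv; rewrite coeffU (inj_eq vtx_inj) (negPf uv) mulr0.
split=> //; apply/isdivP; exists m.
  by move=> e x xe; rewrite Hf //; congr (_ - _); apply: eq_psi => a ae; rewrite cE.
move=> v; rewrite cV; congr (- _); apply: eq_bigr => h _; rewrite /outward.
by congr (if _ then _ else _ - _); apply: eq_csumr => a ae _; rewrite cE.
Qed.

Definition win D := exists2 E, effective E & lin_equiv D E.

Lemma winP D : win D <-> exists f E, isdiv f E /\ effective (D + E).
Proof.
split=> [[E eE [f rf Df]]|[f [E [fE eDE]]]].
  exists (fun p => - f p), (- (D - E)); split; first exact: isdivN.
  by rewrite opprB addrC subrK.
have [rf E'] := isdivN fE.
exists (D + E) => //; exists (fun p => - f p) => // p.
by rewrite opprD addNKr E'.
Qed.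

Lemma effectiveD D E : effective D -> effective E -> effective (D + E).
Proof. by move=> eD eE p; rewrite coeffD addr_ge0. Qed.

Lemma effective_deg D : effective D -> 0 <= deg D.
Proof. by move=> eD; rewrite deg_ev; apply: ev_ge0. Qed.

Lemma effectiveU (k : int) p : 0 <= k -> effective << k *g p >>.
Proof. by move=> k0 q; rewrite coeffU mulr_ge0. Qed.

Lemma effective_sum (I : Type) (r : seq I) (F : I -> divisor G) (P : pred I) :
  (forall i, P i -> effective (F i)) -> effective (\sum_(i <- r | P i) F i).
Proof. by move=> H; apply: big_ind => //; [move=> p; rewrite coeff0|exact: effectiveD]. Qed.

Lemma win_effective D : effective D -> win D.
Proof. by move=> eD; apply/winP; exists (fun=> 0), 0; rewrite addr0; split=> //; exact: isdiv_cst. Qed.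

Lemma winD D E : win D -> win E -> win (D + E).
Proof.
move=> /winP[f [D' [fD eD]]] /winP[g [E' [gE eE]]]; apply/winP.
exists (fun p => f p + g p), (D' + E'); split; first exact: isdivD.
by rewrite addrACA; apply: effectiveD.
Qed.

Lemma win_isdiv f E D : isdiv f E -> win (D + E) -> win D.
Proof.
move=> fE /winP[g [E' [gE eE]]]; apply/winP; exists (fun p => f p + g p), (E + E').
by split; [exact: isdivD|rewrite addrA].
Qed.

Lemma win_isdivN f E D : isdiv f E -> win D -> win (D + E).
Proof. by move=> fE wD; apply: (win_isdiv (isdivN fE)); rewrite addrK. Qed.

Lemma win_deg D : win D -> 0 <= deg D.
Proof.
move=> /winP[f [E [fE /effective_deg]]].
by rewrite degD (isdiv_deg fE) addr0.
Qed.

Lemma win_muln D k : win D -> win (D *+ k).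
Proof.
move=> wD; elim: k => [|k IH]; last by rewrite mulrS; apply: winD.
by apply: win_effective => p; rewrite mulr0n coeff0.
Qed.

Lemma win_sum (I : Type) (r : seq I) (F : I -> divisor G) (P : pred I) :
  (forall i, P i -> win (F i)) -> win (\sum_(i <- r | P i) F i).
Proof.
move=> H; apply: big_ind => //; last exact: winD.
by apply: win_effective => p; rewrite coeff0.
Qed.

Lemma mid_edge e : 0 < len e / 2 < len e.
Proof. by have := len_gt0 e; lra. Qed.

(** The function is a trough: 0 off [e], descending with slope 1 from both ends to a plateau between
    [a] and its mirror image. Loops and the midpoint, where chips coincide, are included. *)
Lemma reflection e a : 0 < a < len e -> exists f,
  isdiv f (<< vtx (src e) >> + << vtx (tgt e) >> - << edge_point e a >> - << edge_point e (len e - a) >>).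
Proof.
move=> ae; have ae' : 0 < len e - a < len e by lra.
pose D : divisor G := - << edge_point e a >> - << edge_point e (len e - a) >>.
pose m e' : int := if e' == e then -1 else 0.
have psiE e' x : psi D e' x = if e == e' then - hinge a x - hinge (len e - a) x else 0.
  rewrite psiD !psiN (psiU 1 e' x ae) (psiU 1 e' x ae').
  by case: ifP => _; rewrite ?mul1r // subr0 oppr0.
have massE e' : mass D e' = if e == e' then - 2 else 0.
  rewrite /mass csumD !csumN (csumU 1 e' predT ae) (csumU 1 e' predT ae') !andbT.
  by case: ifP.
have [|f [D' [fD' _ _ cE cV]]] := @isdiv_build (fun=> 0) m D.
  move=> e'; rewrite psiE /m eq_sym; case: eqP => [<-|_]; last by rewrite mul0r subr0 addr0.
  by rewrite /hinge !max_r ?mulrN1z; lra.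
exists f; congr (isdiv f): fD'; apply: freegP => p.
rewrite -addrA coeffD -/D; case: (pointP p) => [v|e' b be].
  rewrite cV sum_tangent_vtx coeffD /D coeffB coeffN !coeffU.
  rewrite ![edge_point _ _ == vtx v]eq_sym !vtx_neq_edge_point // !mulr0 ?subr0 ?oppr0 ?addr0.
  rewrite (bigD1 e) //= big1 ?addr0 => [|e' /negPf e'e].
    rewrite /outward /= massE /m eqxx !(inj_eq vtx_inj).
    by case: eqP => _; case: eqP.
  rewrite /outward /= massE /m e'e [e == e']eq_sym e'e.
  by case: ifP; case: ifP.
rewrite cE // coeffD [X in _ = X + _](_ : _ = 0) ?add0r //.
by rewrite !coeffU !vtx_neq_edge_point.
Qed.

(* The function is 0 on [Z], a large constant off [Z], and on each edge joining
   the two it is concave with slope 1 at the end outside [Z]. *)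
Lemma fire_complement (Z : pred (vertex G)) : exists f D, [/\ isdiv f D,
  forall e a, 0 < a < len e -> 0 <= coeff (edge_point e a) D,
  forall v, ~~ Z v -> 0 <= coeff (vtx v) D &
  forall h, ~~ Z (origin h) -> Z (target h) -> 0 < coeff (vtx (origin h)) D].
Proof.
pose c : R := 1 + \sum_(e : edge G) len e.
have clen e : len e < c.
  rewrite /c (bigD1 e) //=; have : 0 <= \sum_(i | i != e) len i.
    by apply: sumr_ge0 => i _; apply: ltW; apply: len_gt0.
  by have := len_gt0 e; lra.
(* From the end in [Z] the function is to rise with slope [j + 1] over a distance [b] and then with
   slope 1. Reaching height [c] means [j * b = c - len e], which is positive; [j] is taken so large
   that [b] fits inside the edge. *)
have /choice[jb jbP] : forall e, exists jb : nat * R,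
    0 < jb.2 < len e /\ jb.1%:R * jb.2 = c - len e.
  move=> e; have l0 := len_gt0 e.
  pose j := Num.truncn ((c - len e) / len e).
  have jP : (c - len e) / len e < j.+1%:R.
    exact: truncnS_gt.
  exists (j.+1, (c - len e) / j.+1%:R) => /=; split.
    have j0 : 0 < j.+1%:R :> R by rewrite ltr0n.
    rewrite divr_gt0 ?subr_gt0 //= ltr_pdivrMr // mulrC.
    by rewrite -ltr_pdivrMr.
  by rewrite mulrC divfK // pnatr_eq0.
pose j e := (jb e).1; pose b e := (jb e).2.
pose cross e := Z (src e) != Z (tgt e).
pose a e := if Z (src e) then b e else len e - b e.
have ae e : 0 < a e < len e.
  by rewrite /a; case: ifP => _; have [? _] := jbP e; rewrite /b; lra.
pose n e : int := if cross e then (j e)%:Z else 0.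
pose D := \sum_e << n e *g edge_point e (a e) >>.
pose m e : int := if cross e then (if Z (src e) then (j e).+1%:Z else -1) else 0.
have [|f [D' [fD' _ _ cE cV]]] := @isdiv_build (fun v => if Z v then 0 else c) m D.
  move=> e; rewrite psi_family // /hinge max_r ?subr_ge0 ?(ltW (andP (ae e)).2) //.
  have [_ jbe] := jbP e; rewrite /n /m /a /cross /j /b.
  case: (Z (src e)); case: (Z (tgt e)) => /=; lra.
have outE h : ~~ Z (origin h) -> outward m D h = - (Z (target h))%:Z.
  rewrite /outward /mass csum_family //= /m /n /cross /target /origin.
  case: h => e [] /= /negPf ->; first by case: (Z (tgt e)).
  by case: (Z (src e)) => //=; lia.
exists f, D'; split=> //.
- move=> e x xe; rewrite cE // coeff_edge_family //; case: ifP => // _.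
  by rewrite /n; case: ifP.
- move=> v vZ; rewrite cV -sumrN; apply: sumr_ge0 => h; rewrite tangent_vtx => /eqP hv.
  by rewrite outE ?hv // opprK.
- move=> h hZ tZ; rewrite cV -sumrN (bigD1 h) ?tangent_vtx //= outE // tZ opprK.
  apply: ltr_wpDr => //; apply: sumr_ge0 => h' /andP[]; rewrite tangent_vtx => /eqP hv _.
  by rewrite outE ?hv // opprK.
Qed.

Lemma edge_invariant (Z : pred (vertex G)) :
  (forall e, Z (src e) = Z (tgt e)) -> forall u v, Z u = Z v.
Proof.
move=> H u v; rewrite -[Z u]/(u \in Z) -[Z v]/(v \in Z).
apply: closed_connect (connected_graph u v) => x y.
by move=> /existsP[e /orP[] /andP[/eqP <- /eqP <-]]; rewrite -!topredE /= H.
Qed.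

(** Let [Z] be the set of vertices for which the claim holds. If an edge led from outside [Z] into
    [Z], firing as in [fire_complement] would put a chip on its outer end and create debt only in
    [Z], where multiples of [q0] can pay it. So [Z] is closed under adjacency. *)
Lemma win_vtx (q0 v : vertex G) : exists k : nat, win (<< vtx q0 >> *+ k - << vtx v >>).
Proof.
pose Z : pred (vertex G) := fun v => `[< exists k : nat, win (<< vtx q0 >> *+ k - << vtx v >>) >].
suff H : forall h, Z (target h) -> Z (origin h).
  apply/asboolP; rewrite -[asbool _]/(Z v) -(edge_invariant _ q0).
    by apply/asboolP; exists 1%N; rewrite mulr1n subrr; apply: win_effective => p; rewrite coeff0.
  by move=> e; apply/idP/idP; [exact: (H (e, false))|exact: (H (e, true))].
move=> h tZ; apply/negPn/negP => oZ.
have [f [D [fD DE DV Dh]]] := fire_complement Z.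
have /choice[k kP] : forall u, exists k : nat, Z u -> win (<< vtx q0 >> *+ k - << vtx u >>).
  by move=> u; have [/asboolP[k kP]|_] := boolP (Z u); [exists k|exists 0%N].
(* Enough chips at [u] to cover any debt of [D] there; each of them is paid for by [k u] chips at
   [q0]. *)
pose n u := absz (coeff (vtx u) D).
move/negP: (oZ); apply; apply/asboolP; exists (\sum_(u | Z u) k u * n u)%N.
pose A : divisor G := \sum_(u | Z u) << vtx u >> *+ n u.
have wA : win (\sum_(u | Z u) (<< vtx q0 >> *+ k u - << vtx u >>) *+ n u).
  by apply: win_sum => u uZ; apply/win_muln/kP.
have EA : \sum_(u | Z u) (<< vtx q0 >> *+ k u - << vtx u >>) *+ n u
          = << vtx q0 >> *+ (\sum_(u | Z u) k u * n u)%N - A.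
  rewrite /A -sumrMnr -sumrB; apply: eq_bigr => u _.
  by rewrite mulrnBl mulrnA.
have -> : << vtx q0 >> *+ (\sum_(u | Z u) k u * n u)%N - << vtx (origin h) >> =
   \sum_(u | Z u) (<< vtx q0 >> *+ k u - << vtx u >>) *+ n u + (A - << vtx (origin h) >>).
  by rewrite EA addrA subrK.
apply: winD => //; apply: (win_isdiv fD); apply: win_effective => p.
rewrite coeffD coeffB raddf_sum; case: (pointP p) => [u|e x xe].
  have [uZ|uZ] := boolP (Z u).
    rewrite (bigD1 u) //= big1 => [|w /andP[_ wu]].
      rewrite !coeffMn !coeffU eqxx (inj_eq vtx_inj).
      have -> : (origin h == u) = false by apply: contraNF oZ => /eqP ->.
      by rewrite mulr0 subr0 addr0 mulr1 /n natz; lia.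
    by rewrite coeffMn coeffU (inj_eq vtx_inj) (negPf wu) mulr0 mul0rn.
  rewrite big1 => [|w wZ].
    rewrite coeffU (inj_eq vtx_inj); case: eqP => [<-|_].
      by have := Dh h oZ tZ; lia.
    by rewrite mulr0 subr0 add0r DV.
  rewrite /= coeffMn coeffU (inj_eq vtx_inj).
  have -> : (w == u) = false by apply: contraNF uZ => /eqP <-.
  by rewrite mulr0 mul0rn.
rewrite big1 => [|w wZ]; last by rewrite /= coeffMn coeffU vtx_neq_edge_point // mulr0 mul0rn.
by rewrite coeffU vtx_neq_edge_point // mulr0 subr0 add0r DE.
Qed.

Lemma win_point (q0 : vertex G) p : exists k : nat, win (<< vtx q0 >> *+ k - << p >>).
Proof.
case: (pointP p) => [v|e a ae]; first exact: win_vtx.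
have [k1 w1] := win_vtx q0 (src e); have [k2 w2] := win_vtx q0 (tgt e).
have [f fD] := reflection ae; exists (k1 + k2)%N; apply: (win_isdiv (isdivN fD)).
have := winD (winD w1 w2) (win_effective (@effectiveU 1 (edge_point e (len e - a)) isT)).
by congr win; freeg_ring.
Qed.

Lemma win_addq (q0 : vertex G) D : exists k : nat, win (<< vtx q0 >> *+ k + D).
Proof.
rewrite -(freeg_sumE D).
elim: (dom D) => [|p s [k wk]].
  by exists 0%N; rewrite big_nil addr0 mulr0n; apply: win_effective => q; rewrite coeff0.
have [k' wk'] := win_point q0 p.
rewrite big_cons; have [c0|c0] := leP 0 (coeff p D).
  exists k; rewrite addrCA; apply: winD => //; exact/win_effective/effectiveU.
exists (k' * absz (coeff p D) + k)%N.
have := winD (win_muln (absz (coeff p D)) wk') wk.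
congr win; rewrite mulrnDr mulrnBl mulrnA -!addrA; congr (_ + _).
rewrite [RHS]addrCA; congr (_ + _).
rewrite freegU_muln freegUN; congr << _ *g _ >>; rewrite natz; lia.
Qed.

End Winnable.

(** * Reduced divisors *)

Section Supporting.
Context (R : realType) (G : tropical_curve R).
Implicit Types (P Q : pred R) (D E : divisor G) (e : edge G) (h : half_edge G) (v : vertex G).
Implicit Types (p q : curve_point G) (f : curve_point G -> R) (m : edge G -> int).

Lemma csum_real D e P : (csum D e P)%:~R = ev (fun p => (on_edge e P p)%:R : R) D.
Proof.
rewrite /csum /ev raddf_sum; apply: eq_bigr => p _ /=.
by case: on_edge; rewrite ?mul0rz // intz.
Qed.

(** Each hinge is convex and lies above a supporting line at [x] of slope 0 or 1. A sign condition
    on [D] is imposed only where the line and the hinge differ at [y], so that chips outside the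
    segment between [x] and [y] may be negative. *)
Lemma psi_lower D e P x y :
  (forall a, 0 < a < len e -> hinge a x + (P a)%:R * (y - x) <= hinge a y) ->
  (forall a, 0 < a < len e -> hinge a x + (P a)%:R * (y - x) != hinge a y ->
     0 <= coeff (edge_point e a) D) ->
  psi D e x + (csum D e P)%:~R * (y - x) <= psi D e y.
Proof.
move=> H1 H2; rewrite -subr_ge0 csum_real /psi.
have -> : ev (fun p => (on_edge e P p)%:R : R) D * (y - x) =
          ev (fun p => (on_edge e P p)%:R * (y - x)) D.
  by rewrite /ev mulr_suml; apply: eq_bigr => p _; rewrite mulrzAl.
rewrite opprD -!evNl -!evDl; apply: ev_ge0 => p; case: (pointP p) => [v|e' a ae].
- by rewrite /hinge_at /= mul0r !subr0.
- rewrite /hinge_at on_edge_edge_point // edge_point_val //.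
  have [E|] := eqVneq e' e => /=; last by rewrite mul0r !subr0.
  by subst e'; rewrite -opprD subr_ge0 H1.
- by rewrite /hinge_at /= mul0r !subr0 eqxx.
- rewrite /hinge_at on_edge_edge_point // edge_point_val //.
  have [E|] := eqVneq e' e => /=; last by rewrite mul0r !subr0 eqxx.
  by subst e'; rewrite -opprD subr_eq0 eq_sym; apply: H2.
Qed.

Definition ahead (b : bool) x d : R := if b then x + d else x - d.

Lemma dir_slope_upper f D m e x b d : integrates f D m ->
  0 <= d -> 0 <= x <= len e -> 0 <= ahead b x d <= len e ->
  (forall c, 0 < c < d -> 0 <= coeff (edge_point e (ahead b x c)) D) ->
  f (edge_point e (ahead b x d)) <= f (edge_point e x) + (dir_slope m D e x b)%:~R * d.
Proof.
move=> Hm d0 xe ye H; rewrite !Hm // /dir_slope.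
have := @psi_lower D e (if b then fun a => a <= x else fun a => a < x)%R x (ahead b x d).
case: b ye H => /= ye H.
- have -> : x + d - x = d by ring.
  move=> K; rewrite intrB; have : psi D e x + (csum D e (fun a => a <= x)%R)%:~R * d <= psi D e (x + d).
    apply: K => a ae; rewrite /hinge; case: (leP a x) => ax /=.
    + by rewrite !max_r; lra.
    + by rewrite max_l ?mul0r ?add0r ?le_max ?lexx //; lra.
    + by rewrite !max_r; [move/eqP; case; ring|lra|lra].
    rewrite [Num.max 0 (x - a)]max_l ?mul0r ?add0r; last lra.
    case: (leP (x + d) a) => ad; first by rewrite max_l ?eqxx //; lra.
    have -> : a = x + (a - x) by ring.
    by move=> _; apply: H; lra.
  lra.
- have -> : x - d - x = - d by ring.
  move=> K; rewrite intrB; have : psi D e x + (csum D e (fun a => a < x)%R)%:~R * - d <= psi D e (x - d).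
    apply: K => a ae; rewrite /hinge; case: (ltP a x) => ax /=.
    + by rewrite max_r ?le_max; lra.
    + by rewrite !max_l; lra.
    + rewrite [Num.max 0 (x - a)]max_r; last lra.
      case: (leP a (x - d)) => ad; first by rewrite max_r; [move/eqP; case; ring|lra].
      have -> : a = x - (x - a) by ring.
      by move=> _; apply: H; lra.
    + by rewrite !max_l; [rewrite mul0r addr0 eqxx|lra|lra].
  lra.
Qed.
End Supporting.

(** * The infimum of the admissible functions *)

Section Reduced.
Context (R : realType) (G : tropical_curve R).
Implicit Types (P Q : pred R) (e : edge G) (h : half_edge G) (v : vertex G).
Implicit Types (p : curve_point G) (f : curve_point G -> R) (m : edge G -> int).

Lemma rational_has_slope f p h : rational_function f -> h \in tangent p ->
  has_slope (fun x => f (edge_point h.1 x)) (coordinate p h) h.2 (slope f p h).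
Proof.
move=> rf hp; have [n H] : exists n, has_slope (fun x => f (edge_point h.1 x)) (coordinate p h) h.2 n.
  apply: (piecewise_affine_pwl (rf h.1)).
  by have [_] := tangent_coordinate hp; case: h.2.
by rewrite (slopeE hp H).
Qed.

Lemma slope_min_cst f (t : R) p h : rational_function f -> h \in tangent p ->
  slope (fun p => Num.min (f p) t) p h =
  if f p < t then slope f p h else if t < f p then 0 else Num.min (slope f p h) 0.
Proof.
move=> rf hp; apply: slopeE => //.
have := has_slope_min (rational_has_slope rf hp) (has_slope_cst t (coordinate p h) h.2).
by rewrite (tangent_coordinate hp).1.
Qed.

Lemma rational_min_cst f (t : R) : rational_function f ->
  rational_function (fun p => Num.min (f p) t).
Proof.
move=> rf e; apply: pwl_piecewise_affine; first exact: len_gt0.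
apply: pwl_min; first exact: piecewise_affine_pwl.
by move=> x b _; exists 0; apply: has_slope_cst.
Qed.

Lemma csum_le_deg (E : divisor G) e P : effective E -> csum E e P <= deg E.
Proof.
move=> eE; rewrite -subr_ge0 deg_ev /csum -evNl -evDl; apply: ev_ge0 => // p.
by case: on_edge.
Qed.

Lemma exists_lower_bound (T : finType) (F : T -> R) :
  (forall t, 0 < F t) -> exists2 d, 0 < d & forall t, d <= F t.
Proof.
move=> F0; suff [d d0 H] : exists2 d, 0 < d & forall t, t \in enum T -> d <= F t.
  by exists d => // t; apply: H; rewrite mem_enum.
elim: (enum T) => [|t s [d d0 IH]]; first by exists 1.
exists (Num.min d (F t)); first by rewrite lt_min d0 F0.
move=> u; rewrite inE => /predU1P[->|/IH]; first by rewrite ge_min lexx orbT.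
by rewrite ge_min => ->.
Qed.

Variables (D : divisor G) (q0 : vertex G).
Local Notation q := (vtx q0).
Hypothesis D_off : forall p, p != q -> 0 <= coeff p D.

Let N : int := deg D - coeff q D.
Let Dq : divisor G := D - << coeff q D *g q >>.

Let Dq_effective : effective Dq.
Proof.
move=> p; rewrite coeffB coeffU; have [->|pq] := eqVneq q p.
  by rewrite mulr1 subrr.
by rewrite mulr0 subr0 D_off // eq_sym.
Qed.

Let deg_Dq : deg Dq = N.
Proof. by rewrite degB degU. Qed.

Let csum_Dq e P : csum D e P = csum Dq e P.
Proof. by rewrite csumD csumN csum_vtx subr0. Qed.

Let csum_bound e P : 0 <= csum D e P <= N.
Proof.
rewrite csum_Dq -deg_Dq csum_le_deg // andbT; apply: csum_ge0 => a ae _.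
exact: Dq_effective.
Qed.

Let N_ge0 : 0 <= N.
Proof. by rewrite -deg_Dq effective_deg. Qed.

Definition admissible f := [/\ f q = 0, forall p, f p <= 0 &
  exists2 D', isdiv f D' & forall p, p != q -> 0 <= coeff p (D + D')].

(* The divisor of [min(f, f p)] has degree 0, is at least [- D] off [q], and takes
   at [p] a value of at least [- slope f p h] if this slope is negative. *)
Let slope_ge f p h : admissible f -> h \in tangent p -> - N <= slope f p h.
Proof.
move=> [fq f0 [D' [rf fD'] D'_off]] hp.
have [s0|s0] := leP 0 (slope f p h); first by apply: le_trans s0; rewrite oppr_le0.
set t := f p.
have [E [rg gE]] := isdiv_ex (rational_min_cst t rf).
have : effective (Dq + E + << slope f p h *g p >>).
  move=> p'; rewrite !coeffD coeffU.
  have := Dq_effective p'; rewrite coeffB coeffU => Dp'.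
  have [ft|ft] := ltP (f p') t.
    have -> : coeff p' E = coeff p' D'.
      rewrite gE fD' /div_coeff; congr (- _); apply: eq_bigr => h' hp'.
      by rewrite slope_min_cst // ft.
    have -> : (p == p') = false by apply: contraTF ft => /eqP <-; rewrite ltxx.
    have p'q : p' != q by apply: contraTneq ft => ->; rewrite fq -leNgt /t.
    rewrite coeffN coeffU eq_sym (negPf p'q) !mulr0 subr0 addr0 -coeffD.
    exact: D'_off.
  have sl h' : h' \in tangent p' -> slope (fun p => Num.min (f p) t) p' h' <= 0.
    move=> hp'; rewrite slope_min_cst // ltNge ft /=; case: ifP => //.
    by rewrite ge_min lexx orbT.
  have [pp'|pp'] := eqVneq p p'; last first.
    rewrite mulr0 addr0 coeffN coeffU addr_ge0 // gE /div_coeff oppr_ge0.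
    by apply: sumr_le0.
  subst p'; rewrite mulr1 -addrA coeffN coeffU addr_ge0 // gE /div_coeff (bigD1 h) //=.
  rewrite slope_min_cst // ltxx min_l ?(ltW s0) // opprD addrAC addNr add0r oppr_ge0.
  by apply: sumr_le0 => h' /andP[/sl].
by move/effective_deg; rewrite 2!degD degU deg_Dq (isdiv_deg (conj rg gE)) addr0 -lerBlDl sub0r.
Qed.

(** Looking back from a nearby interior point [y] of the same affine piece reverses the sign of the
    slope, so this is [slope_ge] at [y]. *)
Let slope_le f p h : admissible f -> h \in tangent p -> slope f p h <= N.
Proof.
move=> af hp; have [_ _ [D' [rf _] _]] := af.
have [d d0 H] := rational_has_slope rf hp.
have [_ xe] := tangent_coordinate hp.
case: h hp d0 H xe => e b /= hp d0 H xe; set x := coordinate _ _ in H xe.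
set s := slope _ _ _ in H *.
pose r := if b then len e - x else x.
have r0 : 0 < r by rewrite /r; move: (x) xe => z; case: (b) => /= /andP[]; lra.
pose u := Num.min d r / 2.
have u0 : 0 < u by rewrite divr_gt0 // lt_min d0.
have ud : u < d by rewrite /u; case: (leP d r) => ?; lra.
have ur : u < r by rewrite /u; case: (leP d r) => ?; lra.
set y := if b then x + u else x - u.
have ye : 0 < y < len e.
  by rewrite /y; move: ur xe; rewrite /r; move: (x) => z; case: (b) => /= ? /andP[? ?]; lra.
have hy : (e, ~~ b) \in tangent (edge_point e y).
  exact: mem_tangent_edge.
have : slope f (edge_point e y) (e, ~~ b) = - s.
  apply: slopeE => //=; rewrite /coordinate edge_point_val //.
  exists u => // t /andP[t0 tu].
  have -> : f (edge_point e y) = f (edge_point e x) + s%:~R * u by rewrite -H ?(ltW u0).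
  have := H (u - t); have -> : 0 <= u - t < d by lra.
  move/(_ isT); rewrite mulrNz.
  have -> : (if b then x + (u - t) else x - (u - t)) = (if ~~ b then y + t else y - t).
    by rewrite /y; case: (b) => /=; ring.
  by move=> ->; ring.
by have := slope_ge af hy => /[swap] ->; rewrite lerN2.
Qed.

(** The concave part of an admissible [f]: it is affine minus [psi (D + D') e], where [D'] is the
    divisor of [f] and [D + D'] is nonnegative inside [e]. *)
Let cv f e x : R := f (edge_point e x) - psi D e x.

Let interior_off e a : 0 < a < len e -> edge_point e a != q.
Proof. by move=> ae; rewrite eq_sym vtx_neq_edge_point. Qed.

(** The slope of the supporting line is that of [f], of absolute value at most [N], corrected by the
    number of chips of [D] already passed, which is between 0 and [N]. *)
Let supporting f e x : admissible f -> 0 <= x <= len e ->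
  exists2 s : int, `|s| <= 2 * N &
    forall y, 0 <= y <= len e -> cv f e y <= cv f e x + s%:~R * (y - x).
Proof.
move=> af xe; have [_ _ [D' fD' D'_off]] := af.
have [m Hm DV] := (isdivP _ _).1 fD'.
have cvE y : 0 <= y <= len e -> cv f e y = f (vtx (src e)) + (m e)%:~R * y - psi (D + D') e y.
  by move=> ye; rewrite /cv Hm // psiD; ring.
have sup P : (forall a y, 0 < a < len e -> 0 <= y <= len e ->
    hinge a x + (P a)%:R * (y - x) <= hinge a y) ->
    forall y, 0 <= y <= len e ->
    cv f e y <= cv f e x + (m e - csum (D + D') e P)%:~R * (y - x).
  move=> HP y ye; rewrite !cvE // intrB.
  have := @psi_lower _ _ (D + D') e P x y.
  move=> /(_ (fun a ae => HP a y ae ye)) /(_ (fun a ae _ => D'_off _ (interior_off ae))).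
  lra.
(* At the right end there is no direction to the right; the slope just before that end is used
   instead, with all interior chips counted. *)
move: (xe) => /andP[x0]; rewrite le_eqVlt => /predU1P[xl|xl].
  exists (m e - csum (D + D') e predT); last first.
    apply: (sup predT) => a y ae /andP[y0 yl]; rewrite /hinge max_r /=; last lra.
    by rewrite le_max; apply/orP; right; lra.
  have hT : (e, false) \in tangent (vtx (tgt e)) by rewrite tangent_vtx.
  have := slope_vtx Hm hT; rewrite /outward /mass /= => sE.
  have := slope_ge af hT; have := slope_le af hT; rewrite sE csumD.
  have := csum_bound e predT; lia.
exists (m e - csum (D + D') e (fun a => a <= x)%R); last first.
  apply: (sup (fun a => a <= x)%R) => a y ae /andP[y0 yl]; rewrite /hinge.
  case: (leP a x) => ax /=.
    by rewrite max_r ?le_max; last lra; apply/orP; right; lra.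
  by rewrite max_l ?mul0r ?add0r ?le_max ?lexx //; lra.
suff [p [h [hp sE]]] : exists p h, h \in tangent p /\ slope f p h = m e - csum D' e (fun a => a <= x)%R.
  have := slope_ge af hp; have := slope_le af hp; rewrite sE csumD.
  have := csum_bound e (fun a => a <= x)%R; lia.
move: x0; rewrite le_eqVlt => /predU1P[x0|x0].
  exists (vtx (src e)), (e, true).
  have hT : (e, true) \in tangent (vtx (src e)) by rewrite tangent_vtx.
  by rewrite (integrates_slopeE Hm hT) /dir_slope /coordinate /= x0.
exists (edge_point e x), (e, true).
have hT : (e, true) \in tangent (edge_point e x).
  by apply: mem_tangent_edge; rewrite x0.
by rewrite (integrates_slopeE Hm hT) /dir_slope /coordinate /= edge_point_val ?x0.
Qed.

Let admissible0 : admissible (fun=> 0).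
Proof.
split=> //; exists 0; first exact: isdiv_cst.
by move=> p pq; rewrite addr0 D_off.
Qed.

Let psi_D_ge0 e x : 0 <= psi D e x.
Proof.
apply: ev_ge0 => p.
  by rewrite /hinge_at; case: (point_val p) => // -[e' a]; case: ifP; rewrite // le_max lexx.
case: (pointP p) => [v|e' a ae _]; first by rewrite eqxx.
by apply: D_off; apply: interior_off.
Qed.

Let edge_lower e x : 0 <= x <= len e -> exists c : R, forall f, admissible f ->
  f (edge_point e x) >= f (vtx (src e)) + c /\ f (edge_point e x) >= f (vtx (tgt e)) + c.
Proof.
move=> xe; pose c : R := - (2 * N)%:~R * len e - psi D e (len e); exists c => f af.
have [s sN H] := supporting af xe.
have l0 := len_gt0 e.
have := H 0; have := H (len e); rewrite /cv edge_point0 edge_point_len psi0 !lexx (ltW l0).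
move=> /(_ isT) H1 /(_ isT) H0.
have := psi_D_ge0 e x; have := psi_D_ge0 e (len e).
have s1 : s%:~R <= (2 * N)%:~R :> R by rewrite ler_int; move: sN; lia.
have s2 : (- (2 * N))%:~R <= s%:~R :> R by rewrite ler_int; move: sN; lia.
rewrite mulrNz in s2; set B : R := (2 * N)%:~R in s1 s2 c *.
have k1 : s%:~R * x >= - B * len e.
  have [?|?] := leP 0 (s%:~R : R); first by case/andP: xe => ? ?; nra.
  by case/andP: xe => ? ?; nra.
have k2 : - s%:~R * (len e - x) >= - B * len e.
  have [?|?] := leP 0 (s%:~R : R); first by case/andP: xe => ? ?; nra.
  by case/andP: xe => ? ?; nra.
rewrite /c; split; lra.
Qed.

(** All admissible functions vanish at [q], and by [edge_lower] a bound at one end of an edge gives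
    one on the whole edge; connectedness carries it everywhere. *)
Let lower_bound p : exists c : R, forall f, admissible f -> c <= f p.
Proof.
pose Z : pred (vertex G) := fun v => `[< exists c : R, forall f, admissible f -> c <= f (vtx v) >].
suff ZT v : Z v.
  case: (pointP p) => [v|e a ae]; first by have /asboolP := ZT v.
  have [|c cP] := @edge_lower e a; first by lra.
  have /asboolP[c' c'P] := ZT (src e); exists (c' + c) => f af.
  by apply: le_trans (cP f af).1; rewrite lerD2r c'P.
rewrite -(@edge_invariant _ _ Z _ q0); first by apply/asboolP; exists 0 => f [->].
move=> e; have l0 := ltW (len_gt0 e).
apply/idP/idP => /asboolP[c cP]; apply/asboolP.
  have [|c' c'P] := @edge_lower e (len e); first by rewrite l0 lexx.
  exists (c + c') => f af; have := (c'P f af).1; rewrite edge_point_len.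
  by apply: le_trans; rewrite lerD2r cP.
have [|c' c'P] := @edge_lower e 0; first by rewrite l0 lexx.
exists (c + c') => f af; have := (c'P f af).2; rewrite edge_point0.
by apply: le_trans; rewrite lerD2r cP.
Qed.

Let values p : set R := [set c | exists2 f, admissible f & c = f p]%classic.
Let f0 p : R := inf (values p).

Let values_inf p : has_inf (values p).
Proof.
split; first by exists 0; exists (fun=> 0).
by have [c cP] := lower_bound p; exists c => _ [f af ->]; apply: cP.
Qed.

Let f0_le f p : admissible f -> f0 p <= f p.
Proof. by move=> af; apply: ge_inf; [case: (values_inf p)|exists f]. Qed.

Let le_f0 p c : (forall f, admissible f -> c <= f p) -> c <= f0 p.
Proof.
move=> H; apply: lb_le_inf; first by case: (values_inf p).
by move=> _ [f af ->]; apply: H.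
Qed.

Let f0_adherent p d : 0 < d -> exists2 f, admissible f & f p < f0 p + d.
Proof.
by move=> d0; have [_ [f af ->] H] := inf_adherent d0 (values_inf p); exists f.
Qed.

(* On an edge, f - psi D is concave with slopes in [-2N, 2N], hence a minimum of
   finitely many affine functions a x + b_a; the infimum of these functions over
   all admissible f is obtained by taking the infimum of each b_a. *)
Let rational_f0 : rational_function f0.
Proof.
move=> e; apply: pwl_piecewise_affine; first exact: len_gt0.
have l0 := ltW (len_gt0 e).
pose Cs (a : int) : set R := [set c | exists2 f, admissible f &
   forall y, 0 <= y <= len e -> cv f e y <= a%:~R * y + c]%classic.
have Cs_inf a : has_inf (Cs a).
  split.
    exists (`|a|%:~R * len e); exists (fun=> 0) => // y /andP[y0 yl].
    rewrite /cv sub0r; apply: le_trans (_ : 0 <= _); first by rewrite oppr_le0.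
    have : `|a%:~R : R| * y <= `|a%:~R| * len e by apply: ler_wpM2l.
    rewrite intr_norm; have := ler_norm (- (a%:~R : R)); rewrite normrN.
    by move=> ? ?; nra.
  have [c cP] := lower_bound (vtx (src e)).
  exists c => k [f af /(_ 0)]; rewrite lexx l0 /cv edge_point0 psi0 subr0 mulr0 add0r.
  by move=> /(_ isT); apply: le_trans; apply: cP.
pose B a := inf (Cs a).
pose mn (s : seq int) x := foldr (fun a c => Num.min (a%:~R * x + B a) c) (0 * x + B 0) s.
have mn_le (s : seq int) a x : a \in s -> mn s x <= a%:~R * x + B a.
  elim: s => //= c s IH; rewrite inE ge_min => /predU1P[->|/IH ->]; first by rewrite lexx.
  by rewrite orbT.
have le_mn (s : seq int) c x : (forall a, c <= a%:~R * x + B a) -> c <= mn s x.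
  by move=> H; elim: s => [|a s IH] /=; rewrite ?le_min ?H //; apply: (H 0).
have pwl_mn s : pwl (mn s) (len e).
  have aff a : pwl (fun x => a%:~R * x + B a) (len e).
    move=> x b _; exists (if b then a else - a).
    by have [d d0 H] := has_slope_affine (B a) a x b; exists d => // t /H; rewrite addrC => ->; rewrite addrAC addrC -addrA addrC.
  by elim: s => [|a s IH] /=; [apply: (aff 0)|apply: pwl_min].
pose s : seq int := [seq i%:Z - (2 * N) | i <- iota 0 (absz (4 * N)).+1].
have mem_s a : `|a| <= 2 * N -> a \in s.
  move=> aN; apply/mapP; exists (absz (a + 2 * N)).
    by rewrite mem_iota; move: N_ge0 aN; lia.
  by move: N_ge0 aN; lia.
apply: (@pwl_ext _ (fun x => psi D e x + mn s x)); last first.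
  by apply: pwlD => // x b _; eexists; apply: psi_pwl.
move=> x xe; apply/eqP; rewrite eq_le; apply/andP; split.
  apply: le_f0 => f af; rewrite addrC -lerBrDr -/(cv f e x).
  have [a aN Ha] := supporting af xe.
  apply: le_trans (mn_le s a x (mem_s a aN)) _; rewrite addrC -lerBrDr.
  apply: ge_inf; first by case: (Cs_inf a).
  by exists f => // y ye; apply: le_trans (Ha y ye) _; rewrite mulrBr; lra.
rewrite addrC -lerBlDr; apply: le_mn => a; rewrite -lerBlDl.
apply: lb_le_inf; first by case: (Cs_inf a).
move=> c [f af /(_ x xe)]; rewrite /cv.
by have := f0_le (edge_point e x) af; lra.
Qed.

(* By concavity the slope at [p] of an admissible [f] close to [f0] at [p] exceeds
   that of [f0] minus 1; slopes being integers, it is at least that of [f0]. *)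
Let slope_f0 p h : h \in tangent p -> exists2 d : R, 0 < d &
  forall f, admissible f -> f p < f0 p + d -> slope f0 p h <= slope f p h.
Proof.
move=> hp; have [d1 d10 H1] := rational_has_slope rational_f0 hp.
have [pE] := tangent_coordinate hp.
case: h hp d10 H1 pE => e b /= hp d10 H1 pE xe; rewrite pE in H1.
set x := coordinate _ _ in H1 pE xe.
have [d2 d20 H2] := psi_pwl D e x b.
pose r := if b then len e - x else x.
have r0 : 0 < r by rewrite /r; move: (x) xe => z; case: (b) => /= /andP[]; lra.
pose d := Num.min r (Num.min d1 d2) / 2.
have dm : 0 < Num.min r (Num.min d1 d2) by rewrite !lt_min r0 d10 d20.
have d0 : 0 < d by rewrite divr_gt0.
have : d < Num.min r (Num.min d1 d2) by rewrite /d; lra.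
rewrite !lt_min => /and3P[dr dd1 dd2].
(* The same [d] is the distance travelled and the tolerance at [p], so that the error amounts to
   exactly one unit of slope. *)
exists d => // f af fp; have [_ _ [D' fD' D'_off]] := af.
have [m Hm _] := (isdivP _ _).1 fD'.
have sE := integrates_slopeE Hm hp; rewrite /= -/x in sE.
have xe' : 0 <= x <= len e by move: (x) xe => z; case: (b) => /= /andP[? ?]; lra.
set y := ahead b x d.
have ye : 0 <= y <= len e.
  by rewrite /y /ahead; move: dr xe; rewrite /r; move: (x) => z; case: (b) => /= ? /andP[? ?]; lra.
have psiE : psi D e y = psi D e x + (if b then csum D e (fun a => a <= x)%R
                         else - csum D e (fun a => a < x)%R)%:~R * d.
  by rewrite -H2 ?(ltW d0).
have f0E : f0 (edge_point e y) = f0 p + (slope f0 p (e, b))%:~R * d.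
  by rewrite -H1 ?(ltW d0).
have upper : f (edge_point e y) - psi D e y <= f p - psi D e x +
    (dir_slope m (D + D') e x b)%:~R * d.
  rewrite -[in f p]pE; move: psiE; rewrite !Hm // /dir_slope.
  have := @psi_lower _ _ (D + D') e (if b then fun a => a <= x else fun a => a < x)%R x y.
  move=> /(_ _ (fun a ae _ => D'_off _ (interior_off ae))) K.
  have {}K : psi (D + D') e x + (csum (D + D') e
      (if b then fun a => a <= x else fun a => a < x)%R)%:~R * (y - x) <= psi (D + D') e y.
    apply: K => a ae; rewrite /y /ahead /hinge; case: (b).
      case: (leP a x) => ax /=; last by rewrite max_l ?mul0r ?add0r ?le_max ?lexx //; lra.
      by rewrite max_r ?le_max; last lra; apply/orP; right; lra.
    case: (ltP a x) => ax /=; last by rewrite max_l ?mul0r ?add0r ?le_max ?lexx //; lra.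
    by rewrite max_r ?le_max; last lra; apply/orP; right; lra.
  move: K; rewrite !psiD !csumD /y /ahead; case: (b) => K _.
    have {}K : psi D e x + psi D' e x + (csum D e (fun a => a <= x)%R + csum D' e (fun a => a <= x)%R)%:~R * d
       <= psi D e (x + d) + psi D' e (x + d) by move: K; congr (_ + _ * _ <= _); ring.
    rewrite intrB; lra.
  have {}K : psi D e x + psi D' e x - (csum D e (fun a => a < x)%R + csum D' e (fun a => a < x)%R)%:~R * d
       <= psi D e (x - d) + psi D' e (x - d).
    by apply: le_trans K; rewrite lerD2l le_eqVlt; apply/orP; left; apply/eqP; ring.
  rewrite intrB; lra.
have := f0_le (edge_point e y) af; rewrite f0E => lo.
have key : (slope f0 p (e, b))%:~R * d - d < (slope f p (e, b))%:~R * d.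
  rewrite sE; have : (dir_slope m (D + D') e x b)%:~R * d = (dir_slope m D' e x b)%:~R * d
     - (psi D e y - psi D e x).
    rewrite psiE /dir_slope !csumD; move: (x) (d) => z k; case: (b); rewrite !(intrD, intrN); ring.
  lra.
rewrite -ltzD1 -(@ltr_int R) intrD -(ltr_pM2r d0) mulrDl mul1r; lra.
Qed.

(** At a given [p] different from [q], some admissible [f] is close enough to [f0] for all of the
    finitely many directions at once. Its slopes there are at least those of [f0], so the divisor of
    [f0] at [p] is at least that of [f]. *)
Let admissible_f0 : admissible f0.
Proof.
split.
- apply/eqP; rewrite eq_le; apply/andP; split; first exact: (f0_le q admissible0).
  by apply: le_f0 => f [->].
- by move=> p; apply: (f0_le p admissible0).
have [D0 [rf fD0]] := isdiv_ex rational_f0; exists D0 => // p pq.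
have /choice[d dP] : forall h, exists d : R, 0 < d /\ (h \in tangent p ->
    forall f, admissible f -> f p < f0 p + d -> slope f0 p h <= slope f p h).
  move=> h; have [/slope_f0[d d0 H]|_] := boolP (h \in tangent p); last by exists 1.
  by exists d.
have [c c0 cP] := exists_lower_bound (fun h => (dP h).1).
have [f af fp] := f0_adherent p c0; have [_ _ [D' [_ fD'] D'_off]] := af.
apply: le_trans (D'_off p pq) _; rewrite !coeffD lerD2l fD' fD0 /div_coeff lerN2.
apply: ler_sum => h hp; apply: (dP h).2 => //; apply: lt_le_trans fp _.
by rewrite lerD2l.
Qed.

(** Any [g] that could still be fired makes [f0 + g] admissible, and minimality of [f0] then gives
    [0 <= g]. *)
Lemma reduced_effective_off : exists f E, [/\ isdiv f E,
  forall p, p != q -> 0 <= coeff p (D + E) &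
  forall g F, isdiv g F -> g q = 0 -> (forall p, g p <= 0) ->
    (forall p, p != q -> 0 <= coeff p (D + E + F)) -> forall p, g p = 0].
Proof.
have [fq fle [E fE E_off]] := admissible_f0; exists f0, E; split=> // g F gF gq gle H p.
have : admissible (fun p => f0 p + g p).
  split; first by rewrite fq gq addr0.
    by move=> p'; rewrite -(addr0 0) lerD.
  by exists (E + F); [exact: isdivD|move=> p'; rewrite addrA; apply: H].
move=> /(f0_le p); rewrite lerDl => g0; apply/eqP; rewrite eq_le gle //.
Qed.
End Reduced.

(** Adding chips at [q0] until the divisor is equivalent to an effective one removes the sign
    hypothesis; these chips are invisible to conditions imposed off [q0]. *)
Lemma reduced_divisor (R : realType) (G : tropical_curve R) (D : divisor G) (q0 : vertex G) :
  exists f E, [/\ isdiv f E, forall p, p != vtx q0 -> 0 <= coeff p (D + E) &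
  forall g F, isdiv g F -> g (vtx q0) = 0 -> (forall p, g p <= 0) ->
    (forall p, p != vtx q0 -> 0 <= coeff p (D + E + F)) -> forall p, g p = 0].
Proof.
have [k /winP[f [E [fE eE]]]] := win_addq q0 D.
have [|f' [E' [fE' E'_off H]]] := @reduced_effective_off R G (D + E) q0.
  move=> p pq; have := eE p; rewrite !coeffD coeffMn coeffU eq_sym (negPf pq).
  by rewrite mulr0 mul0rn add0r.
exists (fun p => f p + f' p), (E + E'); split.
- exact: isdivD.
- by move=> p pq; rewrite addrA; apply: E'_off.
- by move=> g F gF gq gle HF; apply: (H g F) => // p pq; rewrite -[D + E + E']addrA; apply: HF.
Qed.

(** * Divisors of acyclic orientations *)

Section Moderators.
Context (R : realType) (G : tropical_curve R).
Implicit Types (D E : divisor G) (e : edge G) (h : half_edge G) (v : vertex G).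
Implicit Types (p : curve_point G) (f : curve_point G -> R).

Lemma exists_min_seq (T : eqType) (F : T -> R) (s : seq T) x0 : x0 \in s ->
  exists2 x, x \in s & forall y, y \in s -> F x <= F y.
Proof.
elim: s x0 => // a s IH x0 _; case: s IH => [|b s] IH.
  by exists a; rewrite ?mem_head // => y; rewrite inE => /eqP ->.
have [x xs xP] := IH b (mem_head _ _).
have [ax|xa] := leP (F a) (F x).
  exists a; rewrite ?mem_head // => y; rewrite inE => /predU1P[->//|/xP]; exact: le_trans.
exists x; first by rewrite inE xs orbT.
by move=> y; rewrite inE => /predU1P[->|/xP //]; apply: ltW.
Qed.

Definition minimum f p := forall p', f p <= f p'.

Lemma exists_minimum f : rational_function f -> exists p, minimum f p.
Proof.
move=> rf.
have /choice[s sP] : forall e, exists s : seq R, forall x, 0 <= x <= len e ->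
    exists2 y, y \in s & f (edge_point e y) <= f (edge_point e x).
  by move=> e; have [s _ H] := piecewise_affine_min (rf e); exists s.
pose L := [seq vtx v | v <- enum (vertex G)] ++
          flatten [seq [seq edge_point e y | y <- s e] | e <- enum (edge G)].
have LP p : exists2 p', p' \in L & f p' <= f p.
  case: (pointP p) => [v|e a ae].
    by exists (vtx v) => //; rewrite mem_cat map_f ?mem_enum.
  have [|y ys fy] := sP e a; first by lra.
  exists (edge_point e y) => //; rewrite mem_cat; apply/orP; right.
  by apply/flatten_mapP; exists e; rewrite ?mem_enum ?map_f.
have /card_gt0P[e _] := edge_nonempty G.
have [p pL _] := LP (vtx (src e)).
have [x xL xP] := exists_min_seq f pL.
by exists x => p'; have [p'' /xP + ] := LP p'; apply: le_trans.
Qed.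

Lemma minimum_slope f p h : rational_function f -> minimum f p -> h \in tangent p ->
  0 <= slope f p h.
Proof.
move=> rf pm hp; have [d d0 H] := rational_has_slope rf hp.
have d2 : 0 <= d / 2 < d by lra.
have := H _ d2; rewrite (tangent_coordinate hp).1 => Hd.
have := pm (edge_point h.1 (if h.2 then coordinate p h + d / 2 else coordinate p h - d / 2)).
by rewrite Hd lerDl pmulr_lge0 ?ler0z; last lra.
Qed.

(** Nonnegative chips between [p] and [y] make [f] concave there, so after starting with slope 0 it
    cannot rise above its minimum. *)
Lemma minimum_flat f D p h y : isdiv f D -> minimum f p -> h \in tangent p ->
  slope f p h = 0 -> 0 <= y <= len h.1 ->
  (if h.2 then coordinate p h <= y else y <= coordinate p h) ->
  (forall a, 0 < a < len h.1 -> (if h.2 then coordinate p h < a < y else y < a < coordinate p h) ->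
     0 <= coeff (edge_point h.1 a) D) ->
  minimum f (edge_point h.1 y).
Proof.
move=> fD pm hp s0 ye yc H p'; apply: le_trans (pm p').
have [m Hm _] := (isdivP _ _).1 fD.
have [pE xe] := tangent_coordinate hp.
rewrite (integrates_slopeE Hm hp) in s0.
move: H pE xe s0 yc ye; set x := coordinate p h; set e := h.1.
move=> H pE xe s0 yc ye.
have := @dir_slope_upper _ _ f D m e x h.2 (if h.2 then y - x else x - y) Hm.
rewrite s0 mul0r addr0 pE.
have -> : ahead h.2 x (if h.2 then y - x else x - y) = y.
  by rewrite /ahead; case: h.2; ring.
apply=> //.
- by move: yc; case: h.2; rewrite subr_ge0.
- by move: xe; case: h.2 => /andP[x0 xl]; rewrite ?x0 ?xl ?ltW.
- move=> c /andP[c0 cd]; apply: H; rewrite /ahead; move: ye xe yc cd.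
    by case: h.2 => /andP[y0 yl] /andP[x0 xl] xy cd; apply/andP; split; lra.
  by case: h.2 => /andP[y0 yl] /andP[x0 xl] xy cd; apply/andP; split; lra.
Qed.

Lemma minimum_target f D v h : isdiv f D -> minimum f (vtx v) -> origin h = v ->
  slope f (vtx v) h = 0 ->
  (forall a, 0 < a < len h.1 -> 0 <= coeff (edge_point h.1 a) D) ->
  minimum f (vtx (target h)).
Proof.
move=> fD vm hv s0 H.
have hT : h \in tangent (vtx v) by rewrite tangent_vtx hv.
have l0 := len_gt0 h.1.
have := @minimum_flat f D (vtx v) h (if h.2 then len h.1 else 0) fD vm hT s0.
have -> : edge_point h.1 (if h.2 then len h.1 else 0) = vtx (target h).
  by rewrite /target /origin /=; case: h.2; rewrite ?edge_point0 ?edge_point_len.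
apply.
- by case: h.2; lra.
- by rewrite /coordinate /=; case: h.2; lra.
- by move=> a ae _; apply: H.
Qed.

Lemma minimum_div f D e a : isdiv f D -> 0 < a < len e -> minimum f (edge_point e a) ->
  exists s1 s2 : int, [/\ 0 <= s1, 0 <= s2, s1 = slope f (edge_point e a) (e, true),
    s2 = slope f (edge_point e a) (e, false) & coeff (edge_point e a) D = - (s1 + s2)].
Proof.
move=> fD ae pm; exists (slope f (edge_point e a) (e, true)), (slope f (edge_point e a) (e, false)).
split=> //; try by apply: minimum_slope; [case: fD| |exact: mem_tangent_edge].
by rewrite fD.2 /div_coeff tangent_edge // big_setU1 ?big_set1 ?inE ?xpair_eqE ?andbF.
Qed.

Lemma minimum_interior f D e a y : isdiv f D -> 0 < a < len e -> minimum f (edge_point e a) ->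
  slope f (edge_point e a) (e, a < y) = 0 -> 0 <= y <= len e ->
  (forall c, 0 < c < len e -> (if a < y then a < c < y else y < c < a) -> 0 <= coeff (edge_point e c) D) ->
  minimum f (edge_point e y).
Proof.
move=> fD ae pm s0 ye H.
have := @minimum_flat f D _ _ y fD pm (mem_tangent_edge _ ae) s0 ye.
rewrite /coordinate edge_point_val //=; apply => //.
by case: ltP => // ?; apply: ltW.
Qed.

Variables (X : edge G -> option R) (tau : vertex G -> nat).
Hypothesis X_interior : forall e a, X e = Some a -> 0 < a < len e.
Hypothesis X_loop : forall e, X e = None -> src e != tgt e.
Hypothesis tau_inj : injective tau.

(** Says that the edge of [h] enters [origin h], so that counting such [h] gives an indegree. An
    edge with a sink inside enters neither of its ends; [X_loop] asks for such a sink on every loop,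
    which would otherwise be a directed cycle. *)
Definition earlier h : bool := (X h.1 == None) && (tau (target h) < tau (origin h))%N.

(* [X e = Some a] means that the moderator has a sink at distance [a] inside [e];
   the edges with [X e = None] are oriented towards the endpoint with the larger
   [tau]. *)
Definition moderator : divisor G :=
  \sum_e << (X e != None)%:Z *g edge_point e (odflt (len e / 2) (X e)) >> +
  \sum_v << \sum_(h in tangent (vtx v)) (earlier h)%:Z - 1 *g vtx v >>.

(** For [X e = None] the midpoint is a mere placeholder: its coefficient in [moderator] is 0. *)
Let Xe e : 0 < odflt (len e / 2) (X e) < len e.
Proof. by case E: (X e) => [a|] /=; [exact: X_interior|exact: mid_edge]. Qed.

Lemma coeff_moderator_edge e a : 0 < a < len e ->
  coeff (edge_point e a) moderator = (X e == Some a)%:Z.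
Proof.
move=> ae; rewrite coeffD coeff_edge_family // raddf_sum big1 ?addr0 => [|v _].
  by case: (X e) => [b|] /=; rewrite ?if_same // (inj_eq Some_inj) eq_sym; case: eqP.
by rewrite /= coeffU vtx_neq_edge_point ?mulr0.
Qed.

Lemma coeff_moderator_vtx v :
  coeff (vtx v) moderator = \sum_(h in tangent (vtx v)) (earlier h)%:Z - 1.
Proof.
rewrite coeffD coeff_vtx_family // add0r raddf_sum (bigD1 v) //= coeffU eqxx mulr1.
by rewrite [X in _ + X]big1 ?addr0 // => u uv; rewrite coeffU (inj_eq vtx_inj) (negPf uv) mulr0.
Qed.

(** Every edge contributes exactly 1, through its interior sink or through the one end it enters,
    and every vertex contributes -1. *)
Lemma deg_moderator : deg moderator = #|edge G|%:Z - #|vertex G|%:Z.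
Proof.
rewrite deg_split (eq_bigr _ (fun v _ => coeff_moderator_vtx v)).
rewrite sumrB sum_tangent addrAC -big_split /= !sumr_const -!natz; congr (_ - _).
rewrite -sumr_const; apply: eq_bigr => e _.
rewrite /mass csumD csum_family // [X in _ + (_ + X)](_ : _ = 0) ?addr0; last first.
  by rewrite /csum ev_sum big1 // => v _; apply: csum_vtx.
rewrite /earlier /target /origin /=; case E: (X e) => [a|] //=.
by have := X_loop E; rewrite -(inj_eq tau_inj); case: ltngtP.
Qed.

(** At a vertex the divisor is the outdegree minus 1. Among the vertices where [f] is minimal take
    [u] with the largest [tau]. Along an edge leaving [u] the slope is at least 1, since slope 0
    would carry the minimum to a later vertex or to an interior sink. So the coefficient at [u]
    becomes negative. *)
Lemma canonical_moderator_lose : ~ win (canonical_divisor G - moderator).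
Proof.
move=> /winP[f [D [fD eD]]].
have [rf _] := fD; have [p0 p0m] := exists_minimum rf.
have KE e a : 0 < a < len e -> coeff (edge_point e a) (canonical_divisor G) = 0.
  move=> ae; rewrite raddf_sum big1 // => v _.
  by rewrite /= coeffU vtx_neq_edge_point ?mulr0.
have KV v : coeff (vtx v) (canonical_divisor G) = (valence (vtx v))%:Z - 2.
  rewrite raddf_sum (bigD1 v) //= coeffU eqxx mulr1 big1 ?addr0 // => u uv.
  by rewrite coeffU (inj_eq vtx_inj) (negPf uv) mulr0.
have DE e a : 0 < a < len e -> (X e == Some a)%:Z <= coeff (edge_point e a) D.
  move=> ae; have := eD (edge_point e a).
  by rewrite coeffD coeffB KE // coeff_moderator_edge //; lia.
have DE0 e a : 0 < a < len e -> 0 <= coeff (edge_point e a) D.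
  by move=> ae; apply: le_trans (DE e a ae).
have source e a : X e = Some a -> ~ minimum f (edge_point e a).
  move=> Xa pm; have ae := X_interior Xa.
  have [s1 [s2 [s10 s20 _ _ Ds]]] := minimum_div fD ae pm.
  by have := DE e a ae; rewrite Xa eqxx Ds; lia.
(* At a minimum inside an edge the coefficient of [D] is nonnegative and is minus a sum of
   nonnegative slopes, so both slopes vanish and the minimum spreads to an end of the edge. *)
have [v vm] : exists v, minimum f (vtx v).
  move: p0m; case: (pointP p0) => [v|e a ae] pm; first by exists v.
  have [s1 [s2 [s10 s20 E1 E2 Ds]]] := minimum_div fD ae pm.
  have sy y : slope f (edge_point e a) (e, a < y) = 0.
    by have := DE0 e a ae; rewrite Ds; case: ltP => _; rewrite -?E1 -?E2; lia.
  have K y : 0 <= y <= len e -> minimum f (edge_point e y).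
    by move=> ye; apply: (minimum_interior fD ae pm (sy y) ye) => c ce _; apply: DE0.
  exists (src e); rewrite -edge_point0; apply: K.
  by rewrite lexx ltW ?len_gt0.
have [u /asboolP um uP] : exists2 u, `[< minimum f (vtx u) >] &
    forall w, `[< minimum f (vtx w) >] -> (tau w <= tau u)%N.
  by case: (@arg_maxnP _ v (fun w => `[< minimum f (vtx w) >]) tau) => [|u]; [apply/asboolP|exists u].
have := eD (vtx u); rewrite coeffD coeffB KV coeff_moderator_vtx (fD.2) /div_coeff.
suff : (valence (vtx u))%:Z - \sum_(h in tangent (vtx u)) (earlier h)%:Z
    <= \sum_(h in tangent (vtx u)) slope f (vtx u) h by lia.
have -> : (valence (vtx u))%:Z = \sum_(h in tangent (vtx u)) (1 : int) by rewrite sumr_const natz.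
rewrite -sumrB.
apply: ler_sum => h hu; have s0 := minimum_slope rf um hu.
case Eh: (earlier h) => //=.
have [sE|/eqP sn] := eqVneq (slope f (vtx u) h) 0; last by lia.
exfalso.
have hT := hu; move: hu; rewrite tangent_vtx => /eqP hu.
case Xh: (X h.1) => [b|].
  apply: (source _ _ Xh); have bh := X_interior Xh.
  apply: (@minimum_flat f D (vtx u) h b) => //; first by rewrite !ltW //; case/andP: bh.
    by rewrite /coordinate /=; case/andP: bh => ? ?; case: h.2; apply: ltW.
  by move=> a ae _; apply: DE0.
have tm : minimum f (vtx (target h)).
  by apply: (minimum_target fD um hu sE) => a ae; apply: DE0.
have := uP (target h) (asboolT tm); rewrite -hu.
move: Eh; rewrite /earlier Xh eqxx /= ltn_neqAle => /[swap] ->.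
rewrite andbT (inj_eq tau_inj) /target /origin /= => /negbFE.
by have := X_loop Xh; case: h.2 => /= /negPf; [rewrite eq_sym|]; move=> ->.
Qed.

End Moderators.

(** * Burning a reduced divisor from the base vertex *)

Section ExistsModerator.
Context (R : realType) (G : tropical_curve R).
Implicit Types (e : edge G) (h : half_edge G) (v : vertex G).
Implicit Types (p : curve_point G) (f : curve_point G -> R).

(** Dhar's burning algorithm: fire crosses the edges in [B], and a vertex burns once more than [c u]
    burning edges reach it. [tau] is the position in the list of burnt vertices; appending to that
    list leaves earlier positions unchanged. *)
Lemma burning_order (q0 : vertex G) (c : vertex G -> int) (B : pred (edge G)) :
  (forall U : pred (vertex G), (exists u, U u) -> ~~ U q0 -> exists2 u, U u &
     c u < \sum_(h in tangent (vtx u)) (B h.1 && ~~ U (target h))%:Z) ->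
  exists2 tau : vertex G -> nat, injective tau & forall u, u != q0 ->
     c u < \sum_(h in tangent (vtx u)) (B h.1 && (tau (target h) < tau u)%N)%:Z.
Proof.
move=> H.
have step n : (n < #|vertex G|)%N -> exists s : seq (vertex G), [/\ uniq s, size s = n.+1,
    q0 \in s & forall u, u \in s -> u != q0 ->
     c u < \sum_(h in tangent (vtx u)) (B h.1 && (index (target h) s < index u s)%N)%:Z].
  elim: n => [_|n IH nV].
    exists [:: q0]; split; rewrite ?mem_head // => u; rewrite inE => /eqP ->.
    by rewrite eqxx.
  have [s [us sz q0s sP]] := IH (ltnW nV).
  have [||v vs cv] := H [pred v | v \notin s]; last 2 first.
  - by rewrite /= q0s.
  - exists (rcons s v); split.
    + by rewrite rcons_uniq us andbT.
    + by rewrite size_rcons sz.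
    + by rewrite mem_rcons inE q0s orbT.
    + move=> u; rewrite mem_rcons inE => /predU1P[-> _|us' uq0].
        apply: lt_le_trans cv _; apply: ler_sum => h _ /=.
        rewrite negbK -cats1 !index_cat (negPf vs) /= eqxx addn0.
        by case: (B h.1) => //=; case: ifP => // ts; rewrite index_mem ts.
      apply: lt_le_trans (sP u us' uq0) _; apply: ler_sum => h _ /=.
      rewrite -cats1 !index_cat us'; case: (B h.1) => //=.
      by case: ifP => // /negbT/memNindex ->; have /negPf -> : ~~ (size s < index u s)%N by rewrite -leqNgt index_size.
  - apply/existsP; rewrite -negb_forall; apply: contraTN nV => /forallP all_s.
    rewrite -leqNgt -sz cardE uniq_leq_size ?enum_uniq //.
have V0 : (0 < #|vertex G|)%N by apply/card_gt0P; exists q0.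
have [|s [us sz _ sP]] := step #|vertex G|.-1; first by rewrite prednK.
have all_s v : v \in s.
  have sub : {subset s <= enum (vertex G)} by move=> w _; rewrite mem_enum.
  have szle : (size (enum (vertex G)) <= size s)%N by rewrite sz prednK // cardE.
  by have [_ ->] := uniq_min_size us sub szle; rewrite mem_enum.
exists (index^~ s) => [u v uv|u uq0]; last exact: sP.
by rewrite -(nth_index q0 (all_s u)) uv nth_index.
Qed.

Variables (D : divisor G) (q0 : vertex G).
Local Notation q := (vtx q0).
Hypothesis D_off : forall p, p != q -> 0 <= coeff p D.
Hypothesis D_reduced : forall g F, isdiv g F -> g q = 0 -> (forall p, g p <= 0) ->
  (forall p, p != q -> 0 <= coeff p (D + F)) -> forall p, g p = 0.

Let edge_off e a : 0 < a < len e -> 0 <= coeff (edge_point e a) D.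
Proof. by move=> ae; apply: D_off; rewrite eq_sym vtx_neq_edge_point. Qed.

(* If [x1] and [x2] both carry a chip, the segment between them can fire. *)
Let reduced_edge e x1 x2 : 0 < x1 -> x1 <= x2 -> x2 < len e ->
  ~ (forall a, 0 < a < len e -> (a == x1)%:Z + (a == x2)%:Z <= coeff (edge_point e a) D).
Proof.
move=> x10 x12 x2l H; have l0 := len_gt0 e.
pose d := Num.min x1 (len e - x2) / 2.
have [d0 d1 d2] : [/\ 0 < d, d < x1 & d < len e - x2].
  by rewrite /d; case: (leP x1 (len e - x2)) => ?; split; lra.
clearbody d.
have i1 : 0 < x1 < len e by lra.
have i2 : 0 < x2 < len e by lra.
have i1' : 0 < x1 - d < len e by lra.
have i2' : 0 < x2 + d < len e by lra.
pose F : divisor G := << edge_point e (x1 - d) >> + << edge_point e (x2 + d) >>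
                      - << edge_point e x1 >> - << edge_point e x2 >>.
have psiE e' x : psi F e' x = if e == e' then
    hinge (x1 - d) x + hinge (x2 + d) x - hinge x1 x - hinge x2 x else 0.
  by rewrite !psiD !psiN !(psiU 1) //; case: ifP => _; rewrite ?mul1r // !subr0 addr0.
have massE e' : mass F e' = 0.
  by rewrite /mass !csumD !csumN !(csumU 1) //; case: ifP.
have [|g [F' [gF gi gV cE cV]]] := @isdiv_build R G (fun=> 0) (fun=> 0) F.
  move=> e'; rewrite mul0r psiE; case: eqP => [<-|_]; last by rewrite subr0 addr0.
  by rewrite /hinge !max_r; lra.
have gE e' x : 0 <= x <= len e' -> g (edge_point e' x) = - psi F e' x.
  by move=> xe; rewrite gi // gV mul0r add0r sub0r.
(* [g] equals [- d] between [x1] and [x2], with a ramp of length [d] on either side, and 0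
   elsewhere. It is a legal firing move, so reducedness would force it to vanish. *)
have : g (edge_point e x1) = 0.
  apply: (D_reduced gF); first exact: gV.
    move=> p; case: (pointP p) => [v|e' a ae]; first by rewrite gV.
    rewrite gE ?psiE; last by lra.
    case: ifP => _; last by rewrite oppr0.
    by clear -d0 x12; do ![case: hingeP => ?]; lra.
  move=> p pq; rewrite coeffD; case: (pointP p) pq => [v|e' a ae] pq.
    rewrite cV big1 ?oppr0 ?addr0 ?D_off // => h _.
    by rewrite /outward massE; case: h.2.
  rewrite cE // !coeffD !coeffN !coeffU !mul1r ![edge_point _ _ == edge_point e' a]edge_point_eq //.
  have [E|] := eqVneq e e'; last by rewrite /= !addr0 edge_off.
  subst e'; have := H a ae; rewrite /= [x1 == a]eq_sym [x2 == a]eq_sym.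
  move: (coeff _ D) (x1 - d == a) (x2 + d == a) (a == x1) (a == x2) => c.
  by do 4![case]; rewrite /=; clear; lia.
rewrite gE ?psiE ?eqxx; last by lra.
by clear -d0 x12; do ![case: hingeP => ?]; lra.
Qed.

(** By [reduced_edge] an open edge carries at most one chip, so its position has the shape of the
    sink data of a moderator. *)
Let chip : exists X0 : edge G -> option R, (forall e a, X0 e = Some a -> 0 < a < len e) /\
  forall e a, 0 < a < len e -> coeff (edge_point e a) D = (X0 e == Some a)%:Z.
Proof.
suff /choice[X0 XP] : forall e, exists X0 : option R, (forall a, X0 = Some a -> 0 < a < len e) /\
  forall a, 0 < a < len e -> coeff (edge_point e a) D = (X0 == Some a)%:Z.
  by exists X0; split=> [e a|e a]; [apply: (XP e).1|apply: (XP e).2].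
move=> e; have [[a [ae aD]]|H] := pselect (exists a, 0 < a < len e /\ coeff (edge_point e a) D != 0).
  exists (Some a); split=> [b [<-//]|b be]; rewrite (inj_eq Some_inj).
  have a1 : 1 <= coeff (edge_point e a) D by have := edge_off ae; move/eqP: aD; lia.
  have [ab|ab] := eqVneq a b.
    subst b; have [a2|a2] := leP 2 (coeff (edge_point e a) D); last by rewrite /=; lia.
    case: (@reduced_edge e a a) => //; [by case/andP: ae|by case/andP: ae|].
    by move=> c ce; case: eqP => [->|_] //=; apply: edge_off.
  have [b1|b1] := leP 1 (coeff (edge_point e b) D); last first.
    by have := edge_off be; rewrite /=; lia.
  have two x y : 0 < x < len e -> 0 < y < len e -> x < y -> 1 <= coeff (edge_point e x) D ->
      1 <= coeff (edge_point e y) D -> False.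
    move=> /andP[x0 xl] /andP[y0 yl] xy xD yD; apply: (@reduced_edge e x y) => //; first exact: ltW.
    move=> c ce; have := edge_off ce; case: eqP => [->|_].
      by rewrite lt_eqF.
    by case: eqP => [->|_].
  by case: (ltgtP a b) ab => // ab _; case: (two _ _ _ _ ab).
exists None; split=> // b be; apply/eqP/negPn/negP => bD; apply: H; by exists b.
Qed.

(* Otherwise [U] can fire: along each edge leaving [U] one chip moves a small
   distance [d] away from [U], starting from the chip inside the edge if there is
   one, and from the endpoint in [U] if not. *)
Lemma reduced_burns (X0 : edge G -> option R) (U : pred (vertex G)) :
  (forall e a, X0 e = Some a -> 0 < a < len e) ->
  (forall e a, 0 < a < len e -> coeff (edge_point e a) D = (X0 e == Some a)%:Z) ->
  (exists u, U u) -> ~~ U q0 ->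
  exists2 u, U u & coeff (vtx u) D <
    \sum_(h in tangent (vtx u)) ((X0 h.1 == None) && ~~ U (target h))%:Z.
Proof.
move=> Xi XD [u Uu] Uq; apply/not_exists2P => H.
have {}H w : U w -> \sum_(h in tangent (vtx w)) ((X0 h.1 == None) && ~~ U (target h))%:Z
    <= coeff (vtx w) D.
  by move=> Uw; have [//|/negP] := H w; rewrite -leNgt.
pose room e := if X0 e is Some a then Num.min a (len e - a) else len e.
have room0 e : 0 < room e.
  rewrite /room; case E: (X0 e) => [a|]; last exact: len_gt0.
  by have /andP[? ?] := Xi _ _ E; rewrite lt_min subr_gt0; apply/andP.
have [d' d'0 d'P] := exists_lower_bound room0.
pose d := d' / 2; have d0 : 0 < d by rewrite /d; lra.
have dP e : d < room e by have := d'P e; rewrite /d; lra.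
pose cross e := U (src e) != U (tgt e).
pose x e := odflt (len e / 2) (X0 e).
pose y e := if U (src e) then odflt 0 (X0 e) + d else odflt (len e) (X0 e) - d.
have xe e : 0 < x e < len e.
  by rewrite /x; case E: (X0 e) => [a|] /=; [exact: Xi|exact: mid_edge].
have ye e : 0 < y e < len e.
  have := dP e; rewrite /y /room; case E: (X0 e) => [a|] /=.
    by have /andP[? ?] := Xi _ _ E; rewrite lt_min => /andP[? ?]; case: ifP => _; lra.
  by case: ifP => _; lra.
pose n1 e : int := - (cross e && (X0 e != None))%:Z.
pose n2 e : int := (cross e)%:Z.
pose F := \sum_e << n1 e *g edge_point e (x e) >> + \sum_e << n2 e *g edge_point e (y e) >>.
pose m e : int := [&& cross e, U (src e) & X0 e == None]%:Z.
have psiE e z : psi F e z = (n1 e)%:~R * hinge (x e) z + (n2 e)%:~R * hinge (y e) z.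
  by rewrite psiD !psi_family.
have [|g [F' [gF gi gV cE cV]]] := @isdiv_build R G (fun v => if U v then - d else 0) m F.
  { move=> e; move: (dP e) (xe e) (ye e) (len_gt0 e).
  rewrite psiE /n1 /n2 /m /x /y /cross /room; move: (len e) => l; clear -d0.
  case: (U (src e)); case: (U (tgt e)); case: (X0 e) => [a|] /=; rewrite ?lt_min => dl xi yi l0.
  all: rewrite ?mulrNz ?mulr0z ?mulr1z /hinge !max_r; lra. }
have outE h : outward m F h = [&& U (origin h), ~~ U (target h) & X0 h.1 == None]%:Z.
  rewrite /outward /mass csumD !csum_family //= /n1 /n2 /m /cross /target /origin /=.
  case: h => e [] /=; case: (U (src e)); case: (U (tgt e)); by case: (X0 e).
have gE e z : 0 <= z <= len e -> g (edge_point e z) =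
    (if U (src e) then - d else 0) + (m e)%:~R * z - psi F e z.
  by move=> ze; rewrite gi // gV.
have : g (vtx u) = 0; last by rewrite gV Uu; lra.
apply: (D_reduced gF); first by rewrite gV (negPf Uq).
  move=> p; case: (pointP p) => [v|e z ze]; first by rewrite gV; case: ifP => _; lra.
  rewrite gE; last by lra.
  { move: (dP e) (xe e) (ye e) (len_gt0 e) ze.
  rewrite psiE /n1 /n2 /m /x /y /cross /room; move: (len e) => l; clear -d0.
  case: (U (src e)); case: (U (tgt e)); case: (X0 e) => [a|] /=; rewrite ?lt_min => dl xi yi l0 zi.
  all: rewrite ?mulrNz ?mulr0z ?mulr1z; do 2![case: hingeP => ?]; lra. }
move=> p pq; rewrite coeffD; case: (pointP p) pq => [v|e a ae] pq; last first.
  rewrite cE // coeffD !coeff_edge_family // XD // /n1 /n2 /x.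
  case: (cross e); case: (X0 e) => [b|] /=; rewrite ?(inj_eq Some_inj) ?[b == a]eq_sym.
  - by do 2![case: ifP].
  - by do 2![case: ifP].
  - by do 2![case: ifP].
  - by do 2![case: ifP].
rewrite cV subr_ge0 (eq_bigr _ (fun h _ => outE h)).
have [Uv|Uv] := boolP (U v).
  apply: le_trans (H v Uv); apply: ler_sum => h; rewrite tangent_vtx => /eqP ->.
  by rewrite Uv /= [_ && (_ == None)]andbC.
rewrite big1 ?D_off // => h; rewrite tangent_vtx => /eqP ->.
by rewrite (negPf Uv).
Qed.

Lemma reduced_moderator : coeff q D < 0 ->
  exists (X : edge G -> option R) (tau : vertex G -> nat), [/\
    (forall e a, X e = Some a -> 0 < a < len e),
    (forall e, X e = None -> src e != tgt e),
    injective tau & effective (moderator X tau - D)].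
Proof.
move=> Dq; have [X0 [X0i X0D]] := chip.
have [tau tau_inj tauP] := @burning_order q0 (fun v => coeff (vtx v) D) (fun e => X0 e == None)
  (fun U ex nq => reduced_burns X0i X0D ex nq).
(* Chip-free loops receive a sink as well. This does not lower the count at their vertex, as a loop
   never joins it to a vertex burnt earlier. *)
pose X e := if X0 e is Some a then Some a else if src e == tgt e then Some (len e / 2) else None.
exists X, tau.
have Xi e a : X e = Some a -> 0 < a < len e.
  rewrite /X; case E: (X0 e) => [b|]; first by case=> <-; apply: X0i.
  by case: ifP => // _ [<-]; apply: mid_edge.
split=> //.
  by move=> e; rewrite /X; case: (X0 e) => // ; case: eqP.
move=> p; rewrite coeffB subr_ge0; case: (pointP p) => [v|e a ae]; last first.
  rewrite coeff_moderator_edge // X0D // /X; case: (X0 e) => [b|] //=.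
rewrite coeff_moderator_vtx //.
have [->|vq] := eqVneq v q0.
  (* A moderator is at least -1 at every vertex, and [coeff q D < 0] makes [D] at most -1 at [q]. *)
  have : 0 <= \sum_(h in tangent (vtx q0)) (earlier X tau h)%:Z by apply: sumr_ge0.
  by lia.
suff : \sum_(h in tangent (vtx v)) ((X0 h.1 == None) && (tau (target h) < tau v)%N)%:Z
    <= \sum_(h in tangent (vtx v)) (earlier X tau h)%:Z by have := tauP v vq; lia.
apply: ler_sum => h; rewrite tangent_vtx /earlier => /eqP hv; rewrite /X hv.
case: (X0 h.1) => //=; have [lp|//] := eqVneq (src h.1) (tgt h.1).
have -> : target h = v by rewrite -hv /target /origin /=; case: h.2; rewrite lp.
by rewrite ltnn.
Qed.
End ExistsModerator.

Theorem win_or_moderator (R : realType) (G : tropical_curve R) (D : divisor G) : ~ win D ->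
  exists (X : edge G -> option R) (tau : vertex G -> nat), [/\
    (forall e a, X e = Some a -> 0 < a < len e),
    (forall e, X e = None -> src e != tgt e),
    injective tau & win (moderator X tau - D)].
Proof.
move=> lD; have /card_gt0P[e _] := edge_nonempty G.
have [f [E [fE E_off E_red]]] := reduced_divisor D (src e).
have [q0|q0] := leP 0 (coeff (vtx (src e)) (D + E)).
  case: lD; apply: (win_isdiv fE); apply: win_effective => p.
  by have [->//|/E_off] := eqVneq p (vtx (src e)).
have [X [tau [Xi Xl tau_inj eX]]] := reduced_moderator E_off E_red q0.
exists X, tau; split=> //; apply: (win_isdiv (isdivN fE)); apply: win_effective.
by move: eX; congr effective; freeg_ring.
Qed.

(** * Riemann-Roch and Clifford *)

Section RiemannRoch.
Context (R : realType) (G : tropical_curve R).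
Implicit Types (D E F : divisor G) (p : curve_point G) (s : seq (curve_point G)).

(** By connectedness the kernel of the transposed boundary matrix consists of the constant vectors,
    so the boundary matrix has rank one less than the number of vertices. *)
Lemma genusE : (genus G + #|vertex G| = #|edge G| + 1)%N.
Proof.
have /card_gt0P[e0 _] := edge_nonempty G; pose v0 := src e0.
rewrite /genus mxrank_ker -mxrank_tr.
set B := boundary_mx G; pose one : 'rV[R]_#|vertex G| := const_mx 1.
have V0 : (0 < #|vertex G|)%N by apply/card_gt0P; exists v0.
have one0 : one != 0.
  apply/eqP => /rowP /(_ (enum_rank v0)); rewrite !mxE; exact/eqP/oner_neq0.
have kerE (u : 'rV[R]_#|vertex G|) : (u <= kermx B^T)%MS -> (u <= one)%MS.
  move=> /sub_kermxP uB; pose c := u 0 (enum_rank v0).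
  have adj e : u 0 (enum_rank (src e)) = u 0 (enum_rank (tgt e)).
    have /rowP/(_ (enum_rank e)) := uB; rewrite !mxE => H.
    apply/eqP; rewrite eq_sym -subr_eq0 -{}H; apply/eqP; apply/esym.
    transitivity (\sum_j u 0 j * ((tgt e == enum_val j)%:R - (src e == enum_val j)%:R)).
      by apply: eq_bigr => j _; rewrite !mxE enum_rankK.
    under eq_bigr do rewrite mulrBr; rewrite sumrB.
    have pick w : \sum_j u 0 j * (w == enum_val j)%:R = u 0 (enum_rank w).
      rewrite (bigD1 (enum_rank w)) //= enum_rankK eqxx mulr1 big1 ?addr0 // => j jw.
      case: eqP => [wj|_]; last by rewrite mulr0.
      by move: jw; rewrite wj enum_valK eqxx.
    by rewrite !pick.
  have ZT v : u 0 (enum_rank v) = c.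
    have := @edge_invariant _ _ (fun v => u 0 (enum_rank v) == c) _ v v0.
    by rewrite /= eqxx => H; apply/eqP/H => e; rewrite adj.
  apply/sub_rVP; exists c; apply/rowP => j; rewrite !mxE mulr1.
  by rewrite -(enum_valK j) ZT.
have rker : \rank (kermx B^T) = 1%N.
  have <- : \rank one = 1%N by rewrite rank_rV one0.
  apply/eqP; rewrite eqn_leq !mxrankS //.
    apply/sub_kermxP/rowP => j; rewrite !mxE.
    transitivity (\sum_(i < #|vertex G|) ((tgt (enum_val j) == enum_val i)%:R - (src (enum_val j) == enum_val i)%:R : R)).
      by apply: eq_bigr => i _; rewrite !mxE mul1r.
    rewrite sumrB.
    have pick w : \sum_(i < #|vertex G|) (w == enum_val i)%:R = 1 :> R.
      rewrite (bigD1 (enum_rank w)) //= enum_rankK eqxx big1 ?addr0 // => i iw.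
      case: eqP => // wi.
      by move: iw; rewrite wi enum_valK eqxx.
    by rewrite !pick subrr.
  by apply/row_subP => i; apply: kerE; apply: row_sub.
move: rker; rewrite mxrank_ker; have := rank_leq_row B; have := rank_leq_col B.
rewrite mxrank_tr; lia.
Qed.

Lemma deg_canonical : deg (canonical_divisor G) = 2 * (genus G)%:Z - 2.
Proof.
have val v : (valence (vtx v))%:Z = \sum_(h in tangent (vtx v)) (1 : int).
  by rewrite sumr_const natz.
rewrite raddf_sum (eq_bigr (fun v => \sum_(h in tangent (vtx v)) 1 - 2)); last first.
  by move=> v _; rewrite /= degU val.
have mulE (n : nat) (k : int) : k *+ n = k * n%:Z by rewrite -mulr_natr natz.
rewrite sumrB sum_tangent !sumr_const (mulE _ (1 + 1)) (mulE _ 2).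
have := genusE; move: #|edge G| #|vertex G| (genus G) => a b c; lia.
Qed.

Definition points s : divisor G := \sum_(p <- s) << p >>.

Lemma points_cat s t : points (s ++ t) = points s + points t.
Proof. exact: big_cat. Qed.

Lemma deg_points s : deg (points s) = (size s)%:Z.
Proof.
rewrite raddf_sum -sum1_size raddf_sum /=; apply: eq_bigr => p _; exact: degU.
Qed.

Lemma effective_points s : effective (points s).
Proof. by apply: effective_sum => p _; apply: effectiveU. Qed.

Lemma effective_pointsP E : effective E -> exists s, E = points s.
Proof.
move=> eE; exists (flatten [seq nseq (absz (coeff p E)) p | p <- dom E]).
rewrite /points big_flatten big_map -{1}(freeg_sumE E); apply: eq_bigr => p _.
by rewrite big_nseq iter_addr_0 freegU_muln natz gez0_abs.
Qed.

Definition has_rank D n := forall s, size s = n -> win (D - points s).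

Let some_point : curve_point G.
Proof. by have /card_gt0P/sigW[e _] := edge_nonempty G; exact: vtx (src e). Defined.

Lemma has_rank_leq D m n : (m <= n)%N -> has_rank D n -> has_rank D m.
Proof.
move=> mn H s sm; have := H (s ++ nseq (n - m) some_point).
rewrite size_cat size_nseq sm subnKC // => /(_ erefl) w.
have := winD w (win_effective (effective_points (nseq (n - m) some_point))).
by congr win; rewrite points_cat; freeg_ring.
Qed.

Lemma has_rank_deg D n : has_rank D n -> n%:Z <= deg D.
Proof.
move=> /(_ (nseq n some_point)); rewrite size_nseq => /(_ erefl) /win_deg.
by rewrite degB deg_points size_nseq subr_ge0.
Qed.

Lemma has_rankD D E m n : has_rank D m -> has_rank E n -> has_rank (D + E) (m + n).
Proof.
move=> HD HE s sz; rewrite -(cat_take_drop m s) points_cat.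
have := winD (HD (take m s) _) (HE (drop m s) _).
rewrite size_takel ?size_drop ?sz ?leq_addr // addKn => /(_ erefl erefl).
by congr win; freeg_ring.
Qed.

Lemma rank_candidateE D n : rank_candidate D n%:Z <-> has_rank D n.
Proof.
split=> [[//|[m [nm] H] s sz]|H].
  rewrite -{}nm -{}sz in H; have [E eE DE] := H (in_tuple s); exists E => //.
  by rewrite /points (big_tnth _ _ s).
right; exists n => // q; have := H q (size_tuple q).
by rewrite /points big_tuple.
Qed.

(** The maximum chosen by [rank] exists because [has_rank D n] forces [n <= deg D]. *)
Lemma rankP D : (rank D = -1 /\ ~ win D) \/ exists n : nat, [/\ rank D = n%:Z, has_rank D n & ~ has_rank D n.+1].
Proof.
have [w0|l0] := pselect (has_rank D 0); last first.
  left; split; last first.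
    by move=> w; apply: l0 => -[|//] _; rewrite /points big_nil subr0.
  apply: xget_unique.
    split; first by left.
    move=> j [->//|[n -> H]]; case: l0; apply: (has_rank_leq (leq0n n)).
    by apply/rank_candidateE; right; exists n.
  move=> k [[//|[n -> H]] _]; case: l0; apply: (has_rank_leq (leq0n n)).
  by apply/rank_candidateE; right; exists n.
right; have ub n : `[< has_rank D n >] -> (n <= absz (deg D))%N.
  by move=> /asboolP /has_rank_deg; lia.
have ex : exists n, `[< has_rank D n >] by exists 0%N; apply/asboolP.
have [n /asboolP Hn maxn] := ex_maxnP ex ub.
exists n; split=> //; last by move=> /asboolT /maxn; rewrite ltnn.
have max j : rank_candidate D j -> j <= n%:Z.
  by move=> [->//|[m -> H]]; apply/maxn/asboolP/rank_candidateE; right; exists m.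
apply: xget_unique; first by split; [apply/rank_candidateE|].
move=> k [/max kn /(_ n%:Z (iffRL (rank_candidateE _ _) Hn)) nk].
by apply/eqP; rewrite eq_le kn nk.
Qed.

Lemma rank_ge D n : n%:Z <= rank D <-> has_rank D n.
Proof.
have [[-> l]|[m [-> H nH]]] := rankP D.
  split=> // /(has_rank_leq (leq0n n)) /(_ [::] erefl).
  by rewrite /points big_nil subr0.
rewrite lez_nat; split=> [mn|Hn]; first exact: has_rank_leq H.
rewrite leqNgt; apply/negP => mn; apply: nH; exact: has_rank_leq Hn.
Qed.

Lemma rank_geN1 D : -1 <= rank D.
Proof. by case: (rankP D) => [[->]|[n [->]]]. Qed.

Lemma rank_lt D n : rank D < n%:Z -> exists2 s, size s = n & ~ win (D - points s).
Proof.
move=> rn; apply: contrapT => H; suff /rank_ge : has_rank D n by rewrite leNgt rn.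
by move=> s sz; apply: contrapT => l; apply: H; exists s.
Qed.

Lemma rank_le_deg D : 0 <= rank D -> rank D <= deg D.
Proof. by case: (rankP D) => [[->]|[n [-> /has_rank_deg]]]. Qed.

Lemma rank_deg_lt0 D : deg D < 0 -> rank D = -1.
Proof. by move=> d0; have := rank_le_deg (D := D); have := rank_geN1 D; lia. Qed.

Lemma rankD D E : 0 <= rank D -> 0 <= rank E -> rank D + rank E <= rank (D + E).
Proof.
case: (rankP D) => [[->//]|[m [-> Hm _]]]; case: (rankP E) => [[->//]|[n [-> Hn _]]] _ _.
by rewrite -PoszD; apply/rank_ge/has_rankD.
Qed.

Local Notation K := (canonical_divisor G).

(** Remove [rank D + 1] points [s] so that [D - s] is not winnable. Some moderator [nu] is then
    equivalent to [D - s + t] with [t] effective, of degree [g - 1 - deg D + rank D + 1]. If [K - D]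
    had rank at least that degree, [K - D - t] would be winnable, and hence so would [K - nu], which
    is equivalent to it plus [s]. *)
Lemma rank_dual_le D : rank (K - D) - rank D <= (genus G)%:Z - 1 - deg D.
Proof.
have [n nE] : exists n : nat, n%:Z = rank D + 1.
  by exists (absz (rank D + 1)); have := rank_geN1 D; lia.
have [|s sz lD] := @rank_lt D n; first by lia.
have [X [tau [Xi Xl tau_inj /winP[f [F [fF eF]]]]]] := win_or_moderator lD.
set nu := moderator X tau in eF.
have [t tE] := effective_pointsP eF.
have dt : (size t)%:Z = (genus G)%:Z - 1 - deg D + n%:Z.
  rewrite -deg_points -tE degD (isdiv_deg fF) (degB nu) (degB D) deg_points sz.
  by rewrite /nu deg_moderator //; have := genusE; lia.
suff : ~ (size t)%:Z <= rank (K - D) by lia.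
move=> /rank_ge /(_ t erefl); rewrite -tE => w.
apply: (@canonical_moderator_lose R G X tau) => //.
have := winD (win_isdivN fF w) (win_effective (effective_points s)).
by congr win; freeg_ring.
Qed.

(** Since [deg K = 2g - 2], the inequality [rank_dual_le] for [K - D] is the reverse of the one for
    [D]. *)
Theorem riemann_roch D : rank D - rank (K - D) = deg D - (genus G)%:Z + 1.
Proof.
have := rank_dual_le D; have := rank_dual_le (K - D).
have -> : K - (K - D) = D by freeg_ring.
by rewrite degB deg_canonical; lia.
Qed.

Lemma rank0 : rank (0 : divisor G) = 0.
Proof.
have := rank_le_deg (D := 0); rewrite deg0.
have /rank_ge : has_rank 0 0.
  by move=> s /size0nil ->; rewrite /points big_nil subr0; apply: win_effective => p; rewrite coeff0.
lia.
Qed.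

Lemma rank_canonical : rank K = (genus G)%:Z - 1.
Proof. by have := riemann_roch K; rewrite subrr rank0 deg_canonical; lia. Qed.

Lemma rank_large D : 2 * (genus G)%:Z - 2 < deg D -> rank D = deg D - (genus G)%:Z.
Proof.
move=> d; have := riemann_roch D; rewrite (rank_deg_lt0 (D := K - D)); first lia.
by rewrite degB deg_canonical; lia.
Qed.

(** If both ranks are nonnegative, [rankD] bounds their sum by [rank K = g - 1], and Riemann-Roch
    gives their difference. If [K - D] has rank -1, Riemann-Roch alone suffices in this range of
    degrees. *)
Lemma clifford D : 0 <= deg D <= 2 * (genus G)%:Z - 2 -> 2 * rank D <= deg D.
Proof.
move=> /andP[d0 d1]; have RR := riemann_roch D.
have := rank_geN1 (K - D); have := rankD (D := D) (E := K - D).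
have -> : D + (K - D) = K by freeg_ring.
by rewrite rank_canonical; lia.
Qed.

End RiemannRoch.

(** * Weights *)

Section Weights.
Context (R : realType) (G : tropical_curve R).
Implicit Types (D : divisor G) (p : curve_point G).

Lemma rank_sub_point D p : rank (D - << p >>) <= rank D <= rank (D - << p >>) + 1.
Proof.
apply/andP; split.
  case: (rankP (D - << p >>)) => [[-> _]|[n [-> H _]]]; first exact: rank_geN1.
  apply/rank_ge => s sz; have := winD (H s sz) (win_effective (@effectiveU _ _ 1 p isT)).
  by congr win; freeg_ring.
case: (rankP D) => [[-> _]|[[|n] [-> H _]]].
- by have := rank_geN1 (D - << p >>); lia.
- by have := rank_geN1 (D - << p >>); lia.
suff /rank_ge : has_rank (D - << p >>) n by lia.
move=> s sz; have := H (p :: s); rewrite /= sz => /(_ erefl).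
by congr win; rewrite /points big_cons; freeg_ring.
Qed.

(** Summation by parts: a drop at [m] adds 1 to each of the [m] values [rho 0], ..., [rho m.-1]. *)
Lemma drops_count (rho : nat -> nat) M : (forall m, (rho m.+1 <= rho m <= (rho m.+1).+1)%N) ->
  let s := [seq m <- iota 1 M | (rho m < rho m.-1)%N] in
  (size s + rho M = rho 0)%N /\ (\sum_(m <- s) m + M * rho M = \sum_(m < M) rho m)%N.
Proof.
move=> H s; rewrite {}/s; elim: M => [|M [IH1 IH2]]; first by rewrite !big_nil big_ord0.
have -> : iota 1 M.+1 = iota 1 M ++ [:: M.+1] by have := iotaD 1 M 1; rewrite addn1 add1n.
rewrite filter_cat size_cat big_cat big_ord_recr /= -IH2 -IH1.
have := H M; case: ltnP => h; rewrite /= ?big_cons ?big_nil; nia.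
Qed.

(** The gaps are the places where [rank (D - m p) + 1] drops, always by 1, and this number is 0 from
    [M] on because the degree is negative there. *)
Lemma weightE D p (M : nat) : deg D < M%:Z ->
  weight D p = \sum_(m < M) (rank (D - << p >> *+ m) + 1)
               - \sum_(i < absz (rank D + 1)) i.+1%:Z.
Proof.
move=> dM; pose r m := rank (D - << p >> *+ m).
have rS m : r m.+1 <= r m <= r m.+1 + 1.
  have := rank_sub_point (D - << p >> *+ m) p.
  by rewrite (_ : D - _ - _ = D - << p >> *+ m.+1) //; freeg_ring.
have rN1 m : -1 <= r m by apply: rank_geN1.
have rM m : (M <= m)%N -> r m = -1.
  by move=> Mm; apply: rank_deg_lt0; rewrite degB degMn degU natz; lia.
pose rho m := absz (r m + 1).
have rhoS m : (rho m.+1 <= rho m <= (rho m.+1).+1)%N.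
  by rewrite /rho; move: (rS m) (rN1 m) (rN1 m.+1); lia.
have [] := drops_count M rhoS; set s := [seq _ <- _ | _].
have -> : rho M = 0%N by rewrite /rho rM.
rewrite muln0 !addn0 => sz sm.
have gapsE : gap_seq D p = s.
  have s_sorted : sorted ltn s.
    by apply: sorted_filter; [exact: ltn_trans|exact: iota_ltn_sorted].
  have s_gap m : m \in s <-> is_gap D p m.
    rewrite mem_filter mem_iota /is_gap -/(r m) -/(r m.-1).
    have rhoE : (rho m < rho m.-1)%N = (r m < r m.-1).
      by rewrite /rho; move: (rN1 m) (rN1 m.-1); lia.
    rewrite rhoE; split=> [/and3P[-> -> _] //|[m0 rr]]; rewrite rr m0 add1n ltnS /=.
    rewrite leqNgt; apply/negP => Mm; move: rr; rewrite (rM m (ltnW Mm)) (rM m.-1) //; lia.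
  apply: xget_unique; first by split.
  move=> t [t_sorted t_gap]; apply: (irr_sorted_eq ltn_trans ltnn) => // m.
  by apply/idP/idP => [/t_gap/s_gap|/s_gap/t_gap].
have r0 : r 0%N = rank D by rewrite /r mulr0n subr0.
rewrite /weight gapsE sumrB -r0 -/(rho 0%N) -sz; congr (_ - _).
rewrite -(big_mkord xpredT (fun i => (nth 0%N s i)%:Z)) -(big_nth 0%N xpredT (fun i => i%:Z)).
rewrite -[LHS]raddf_sum /= sm raddf_sum; apply: eq_bigr => m _ /=.
rewrite -/(r m) /rho gez0_abs //; have := rN1 m; lia.
Qed.

Definition clifford_bound (e : nat) : nat :=
  if (e <= 2 * genus G - 2)%N then e./2.+1 else (e - genus G).+1.

Lemma rank_clifford_bound D (e : nat) : (0 < genus G)%N -> deg D = e%:Z ->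
  rank D + 1 <= (clifford_bound e)%:Z.
Proof.
move=> g0 dD; rewrite /clifford_bound; case: leqP => h.
  by have := clifford (D := D); have := odd_double_half e; lia.
by rewrite rank_large; lia.
Qed.

(** The first [2g - 1] values sum to g^2, and the value in degree [2g - 1 + k] is [g + k], the next
    term of the triangular sum. The sum over [g - 1] terms on the left avoids a truncated
    subtraction. *)
Lemma sum_clifford_bound k : (0 < genus G)%N ->
  (\sum_(e < 2 * genus G - 1 + k) clifford_bound e + \sum_(i < genus G - 1) i.+1
   = genus G ^ 2 + \sum_(i < genus G - 1 + k) i.+1)%N.
Proof.
move=> g0; elim: k => [|k IH]; last first.
  rewrite !addnS !big_ord_recr /= addnAC IH -addnA; congr (_ + (_ + _))%N.
  rewrite /clifford_bound ifF; first by move: (genus G) g0 => a; lia.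
  by apply/negP; move: (genus G) g0 => a; lia.
rewrite !addn0; congr (_ + _)%N.
rewrite /clifford_bound.
transitivity (\sum_(e < 2 * genus G - 1) e./2.+1)%N.
  by apply: eq_bigr => e _; rewrite ifT //; have := ltn_ord e; lia.
case: (genus G) g0 => // g _; elim: g => [|g IH]; first by rewrite big_ord_recr big_ord0.
have -> : (2 * g.+2 - 1 = (2 * g.+1 - 1).+2)%N by lia.
rewrite !big_ord_recr /= IH; lia.
Qed.

Lemma triangular n : (2 * \sum_(i < n) i.+1 = n * n.+1)%N.
Proof. by elim: n => [|n IH]; rewrite ?big_ord0 // big_ord_recr /= mulnDr IH; lia. Qed.

End Weights.

(** * The two weight bounds and their equality cases *)

Section WeightBounds.
Context (R : realType) (G : tropical_curve R).
Implicit Types (D : divisor G) (p : curve_point G).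
Hypothesis g_gt0 : (0 < genus G)%N.

Let deg_sub D p (d m : nat) : deg D = d%:Z -> (m <= d)%N ->
  deg (D - << p >> *+ m) = (d - m)%N%:Z.
Proof. by move=> dD md; rewrite degB degMn degU natz dD; lia. Qed.

Let sum_ranks D p (d : nat) : deg D = d%:Z ->
  \sum_(m < d.+1) (rank (D - << p >> *+ m) + 1) <= (\sum_(e < d.+1) clifford_bound G e)%N%:Z.
Proof.
move=> dD; rewrite [in leRHS](reindex_inj rev_ord_inj) raddf_sum; apply: ler_sum => m _.
by rewrite /= subSS; apply: rank_clifford_bound => //; apply: deg_sub; rewrite // -ltnS.
Qed.

Let sum_ranks_eq D p (d : nat) : deg D = d%:Z ->
  (forall m, (m <= d)%N -> rank (D - << p >> *+ m) + 1 = (clifford_bound G (d - m))%:Z) ->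
  \sum_(m < d.+1) (rank (D - << p >> *+ m) + 1) = (\sum_(e < d.+1) clifford_bound G e)%N%:Z.
Proof.
move=> dD H; rewrite [in RHS](reindex_inj rev_ord_inj) raddf_sum; apply: eq_bigr => m _.
by rewrite /= subSS H // -ltnS.
Qed.

Let sum_triangular n : \sum_(i < n) i.+1%:Z = (\sum_(i < n) i.+1)%N%:Z :> int.
Proof. by rewrite raddf_sum. Qed.

Let bound_canonical :
  (\sum_(e < (2 * genus G - 2).+1) clifford_bound G e)%N%:Z
   - \sum_(i < genus G) i.+1%:Z = ((genus G * (genus G - 1)) %/ 2)%N%:Z.
Proof.
have := sum_clifford_bound 0 g_gt0; rewrite !addn0 => /addIn.
have -> : (2 * genus G - 1 = (2 * genus G - 2).+1)%N by lia.
move=> ->; rewrite sum_triangular.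
have := triangular (genus G); set T := (\sum_(i < _) _)%N => HT.
have -> : (genus G * (genus G - 1) = (genus G ^ 2 - T) * 2)%N.
  by move: (genus G) T HT => g T; case: g => [|g]; rewrite ?subn1 /=; nia.
rewrite mulnK // -subzn //; move: (genus G) T HT => g T; nia.
Qed.

Let bound_large (d : nat) : (2 * genus G - 2 < d)%N ->
  (\sum_(e < d.+1) clifford_bound G e)%N%:Z
   - \sum_(i < (d - genus G).+1) i.+1%:Z = ((genus G * (genus G + 1)) %/ 2)%N%:Z.
Proof.
move=> gd; have := sum_clifford_bound (d.+1 - (2 * genus G - 1)) g_gt0.
have -> : (2 * genus G - 1 + (d.+1 - (2 * genus G - 1)) = d.+1)%N by lia.
have -> : (genus G - 1 + (d.+1 - (2 * genus G - 1)) = (d - genus G).+1)%N by lia.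
rewrite sum_triangular; have := triangular (genus G - 1).
set T := (\sum_(i < genus G - 1) _)%N; set S := (\sum_(i < (d - _).+1) _)%N.
set C := (\sum_(e < _) _)%N; clearbody T S C => HT HC.
have -> : (genus G * (genus G + 1) = (genus G ^ 2 - T) * 2)%N.
  by move: (genus G) g_gt0 HT {HC gd} => g; case: g => // g _; rewrite subn1 /=; nia.
have TG : (T <= genus G ^ 2)%N.
  by move: (genus G) g_gt0 HT {HC gd} => g; case: g => // g _; rewrite subn1 /=; nia.
by rewrite mulnK // -subzn //; lia.
Qed.

Lemma weight_canonical_le p :
  weight (canonical_divisor G) p <= ((genus G * (genus G - 1)) %/ 2)%N%:Z.
Proof.
have dK : deg (canonical_divisor G) = (2 * genus G - 2)%N%:Z by rewrite deg_canonical; lia.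
rewrite (weightE p (M := (2 * genus G - 2).+1)); last by rewrite dK ltz_nat.
rewrite rank_canonical subrK absz_nat -bound_canonical lerD2r.
exact: sum_ranks.
Qed.

Lemma weight_large_le D p : 2 * (genus G)%:Z - 2 < deg D ->
  weight D p <= ((genus G * (genus G + 1)) %/ 2)%N%:Z.
Proof.
move=> dg; have [d dD] : exists d : nat, deg D = d%:Z by exists (absz (deg D)); lia.
rewrite (weightE p (M := d.+1)); last by rewrite dD ltz_nat.
have -> : absz (rank D + 1) = (d - genus G).+1 by rewrite rank_large // dD; lia.
have gd : (2 * genus G - 2 < d)%N by move: dg; rewrite dD; lia.
by rewrite -(bound_large gd) lerD2r; exact: sum_ranks.
Qed.

Lemma weight_canonical_eq p :
  (forall m, (m <= 2 * genus G - 2)%N ->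
     rank (canonical_divisor G - << p >> *+ m) + 1 = (clifford_bound G (2 * genus G - 2 - m))%:Z) ->
  weight (canonical_divisor G) p = ((genus G * (genus G - 1)) %/ 2)%N%:Z.
Proof.
have dK : deg (canonical_divisor G) = (2 * genus G - 2)%N%:Z by rewrite deg_canonical; lia.
move=> H; rewrite (weightE p (M := (2 * genus G - 2).+1)); last by rewrite dK ltz_nat.
by rewrite rank_canonical subrK absz_nat -bound_canonical (sum_ranks_eq dK).
Qed.

Lemma weight_large_eq D p (d : nat) : deg D = d%:Z -> (2 * genus G - 2 < d)%N ->
  (forall m, (m <= d)%N -> rank (D - << p >> *+ m) + 1 = (clifford_bound G (d - m))%:Z) ->
  weight D p = ((genus G * (genus G + 1)) %/ 2)%N%:Z.
Proof.
move=> dD dg H; rewrite (weightE p (M := d.+1)); last by rewrite dD ltz_nat.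
have -> : absz (rank D + 1) = (d - genus G).+1 by rewrite rank_large dD; lia.
by rewrite -(bound_large dg) (sum_ranks_eq dD).
Qed.

End WeightBounds.

(** * The rose with g petals *)

Section Rose.
Context (R : realType) (g : nat).
Hypothesis g_gt0 : (0 < g)%N.

Let rose_len_gt0 (e : 'I_g) : 0 < (1 : R).
Proof. exact: ltr01. Qed.

Let rose_nonempty : (0 < #|'I_g|)%N.
Proof. by rewrite card_ord. Qed.

Let rose_connected (u v : unit) :
  connect (fun x y => [exists e : 'I_g, ((tt == x) && (tt == y)) || ((tt == y) && (tt == x))]) u v.
Proof. by case: u; case: v; apply: connect0. Qed.

Definition rose : tropical_curve R :=
  @TropicalCurve R unit 'I_g (fun=> tt) (fun=> tt) (fun=> 1) rose_len_gt0 rose_nonempty rose_connected.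

Lemma genus_rose : genus rose = g.
Proof. by have := genusE rose; rewrite card_unit card_ord; lia. Qed.

Definition rose_center : curve_point rose := @vtx R rose tt.
Local Notation p := rose_center.

Lemma canonical_rose : canonical_divisor rose = << p >> *+ (2 * g - 2).
Proof.
have := deg_canonical rose; rewrite genus_rose /canonical_divisor (big_pred1 tt) => [|[] //].
by rewrite degU => ->; rewrite freegU_muln natz; congr << _ *g _ >>; lia.
Qed.

Lemma has_rank_rose2 : has_rank (<< p >> *+ 2) 1.
Proof.
case=> [//|x [|y s //]] _; rewrite /points big_seq1.
case: (pointP x) => [[]|e a ae].
  by apply: win_effective => q; rewrite mulr2n addrK; apply: effectiveU.
have [f fD] := reflection ae; apply: (win_isdiv (isdivN fD)).
have := win_effective (@effectiveU R rose 1 (edge_point e (len e - a)) isT).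
by congr win; freeg_ring.
Qed.

(** Each pair of chips at the centre answers one point by reflection in its petal; for odd [n] the
    remaining chip stays put. *)
Lemma has_rank_rose n : has_rank (<< p >> *+ n) n./2.
Proof.
have double k : has_rank (<< p >> *+ (k.*2)) k.
  elim: k => [|k IH].
    by move=> s /size0nil ->; rewrite /points big_nil subr0; apply: win_effective => q; rewrite coeff0.
  by rewrite -addn1 doubleD mulrnDr; apply: has_rankD; [|exact: has_rank_rose2].
rewrite -{1}[n]odd_double_half mulrnDr addrC => s sz.
rewrite addrAC; apply: winD; first exact: double.
by apply: win_muln; apply: win_effective; apply: effectiveU.
Qed.

Lemma rank_rose n : rank (<< p >> *+ n : divisor rose) + 1 = (clifford_bound rose n)%:Z.
Proof.
have dn : deg (<< p >> *+ n : divisor rose) = n%:Z by rewrite degMn degU natz.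
have := rank_clifford_bound (G := rose) _ dn; rewrite genus_rose => /(_ g_gt0) ub.
apply/eqP; rewrite eq_le ub /= /clifford_bound; case: ifP => h.
  by rewrite -addn1 PoszD lerD2r; apply/rank_ge; exact: has_rank_rose.
move: h; rewrite genus_rose => h; rewrite rank_large dn genus_rose; lia.
Qed.

End Rose.

(* All divisions by 2 below are exact. *)
Theorem proposition1p3 (R : realType) (g : nat) (hg : (2 <= g)%N) :
  (forall (G : tropical_curve R) (D : divisor G) (p : curve_point G),
     genus G = g -> 0 <= rank D ->
     (D = canonical_divisor G -> weight D p <= ((g * (g - 1)) %/ 2)%N%:Z) /\
     (2 * g%:Z - 2 < deg D -> weight D p <= ((g * (g + 1)) %/ 2)%N%:Z)) /\
  (exists (G : tropical_curve R) (p : curve_point G),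
     genus G = g /\
     weight (canonical_divisor G) p = ((g * (g - 1)) %/ 2)%N%:Z) /\
  (forall d : int, 2 * g%:Z - 2 < d ->
     exists (G : tropical_curve R) (D : divisor G) (p : curve_point G),
       [/\ genus G = g, deg D = d &
           weight D p = ((g * (g + 1)) %/ 2)%N%:Z]).
Proof.
have g0 : (0 < g)%N by apply: leq_trans hg.
split=> [G D p gG _|]; first subst g.
  by split=> [->|]; [exact: weight_canonical_le|exact: weight_large_le].
have gR := genus_rose R g0; split.
  exists (rose R g0), (rose_center R g0); split=> //; rewrite -[in RHS]gR.
  (* The rose has a single vertex, so [K - m p] is again a multiple of [p], whose rank is known
     exactly. *)
  apply: weight_canonical_eq; rewrite gR // => m mg.
  by rewrite canonical_rose -mulrnBr // rank_rose.
move=> d dg; have [n dn] : exists n : nat, d = n%:Z by exists (absz d); lia.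
exists (rose R g0), (<< rose_center R g0 >> *+ n), (rose_center R g0).
have dD : deg (<< rose_center R g0 >> *+ n : divisor (rose R g0)) = n%:Z.
  by rewrite degMn degU natz.
split; rewrite ?dD //.
have := @weight_large_eq _ (rose R g0) _ _ (rose_center R g0) n dD; rewrite gR; apply=> //; first by lia.
by move=> m mn; rewrite -mulrnBr // rank_rose.
Qed.
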